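(* Assume $\mathcal D$ is either $\mathcal F_0(s)$ with $0\le s<s_{\max}(\delta)$ or $\mathcal F_p(\xi)$ with $\xi,p>0$. There exist constants $\beta_{\min},\tau_{\max}>0$ depending only on $\Omega$ such that for all $\theta^\star\in\mathcal D$ and all $\lambda\in[\lambda_{\min},\lambda_{\max}]$, $$\beta_{\min}\le\beta_*(\lambda)\qquad\text{and}\qquad\sigma\le\tau_*(\lambda)\le\tau_{\max}.$$ Moreover, if $\delta\in(0,1)$ then also $\beta_*(\lambda)<\lambda/\alpha_{\min}(\delta)$.
   Context: Fix $\delta>0$, $\sigma>0$, integers $N$, $\theta^\star\in\mathbb R^N$. $\eta(x;b)=\mathrm{sign}(x)(|x|-b)_+$; $\phi,\Phi$ standard normal density and cdf. Let $(\Theta,Z)\sim\hat\mu_{\theta^\star}\otimes\mathcal N(0,1)$ with $\hat\mu_{\theta^\star}=\frac1N\sum_i\delta_{\theta^\star_i}$, and $\psi_\lambda(\beta,\tau)=(\frac{\sigma^2}{\tau}+\tau)\frac\beta2-\frac12\beta^2+\frac1\delta\mathbb E\min_{w\in\mathbb R}\{\frac{w^2}{2\tau}\beta-\beta Zw+\lambda|w+\Theta|-\lambda|\Theta|\}$; $(\beta_*(\lambda),\tau_*(\lambda))$ is the unique pair attaining $\max_{\beta\ge0}\min_{\tau\ge\sigma}\psi_\lambda$. For $\delta\in(0,1)$, $\alpha_{\min}(\delta)$ is the unique positive solution $\alpha$ of $(1+\alpha^2)\Phi(-\alpha)-\alpha\phi(\alpha)=\delta/2$. $\mathcal F_p(\xi)=\{x:\frac1N\sum|x_i|^p\le\xi^p\}$,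 $\mathcal F_0(s)=\{x:\|x\|_0\le sN\}$, $s_{\max}(\delta)=\delta\max_{\alpha\ge0}\frac{1-\frac2\delta M(\alpha)}{1+\alpha^2-2M(\alpha)}$ with $M(\alpha)=(1+\alpha^2)\Phi(-\alpha)-\alpha\phi(\alpha)$. Fix $0<\lambda_{\min}\le\lambda_{\max}$; $\Omega=(\delta,\sigma,\mathcal D,\lambda_{\min},\lambda_{\max})$; constants depending only on $\Omega$ do not depend on $N,\theta^\star,\lambda$. *)

(* Defs.v *)
From Stdlib Require Import Reals Lra ClassicalEpsilon.
Open Scope R_scope.

Definition phi (x : R) : R := exp (- (x ^ 2) / 2) / sqrt (2 * PI).

Definition ImpInt_to (f : R -> R) (lo hi : R -> R) (v : R) : Prop :=
  forall eps, 0 < eps -> exists A, forall a, A <= a ->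
    exists pr : Riemann_integrable f (lo a) (hi a), Rabs (RiemannInt pr - v) < eps.

Definition Phi (x : R) : R :=
  epsilon (inhabits 0) (fun v => ImpInt_to phi (fun a => - a) (fun _ => x) v).

Definition gauss_E (g : R -> R) : R :=
  epsilon (inhabits 0)
    (fun v => ImpInt_to (fun z => g z * phi z) (fun a => - a) (fun a => a) v).

Definition min_val (f : R -> R) : R :=
  epsilon (inhabits 0) (fun m => (exists w, f w = m) /\ forall w, m <= f w).

Fixpoint sumN (N : nat) (f : nat -> R) : R :=
  match N with O => 0 | S n => sumN n f + f n end.

(* psi_lambda(beta,tau), with Theta ~ empirical measure of theta_1..theta_N *)
Definition psi (delta sigma : R) (N : nat) (theta : nat -> R) (lam beta tau : R) : R :=
  (sigma ^ 2 / tau + tau) * beta / 2 - / 2 * beta ^ 2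
  + / delta * (/ INR N * sumN N (fun i =>
      gauss_E (fun z => min_val (fun w =>
        w ^ 2 / (2 * tau) * beta - beta * z * w
        + lam * Rabs (w + theta i) - lam * Rabs (theta i))))).

Definition maxmin_pair (delta sigma : R) (N : nat) (theta : nat -> R) (lam beta tau : R) : Prop :=
  0 <= beta /\ sigma <= tau /\
  (forall tau', sigma <= tau' ->
     psi delta sigma N theta lam beta tau <= psi delta sigma N theta lam beta tau') /\
  (forall beta', 0 <= beta' -> forall eps, 0 < eps -> exists tau', sigma <= tau' /\
     psi delta sigma N theta lam beta' tau' <= psi delta sigma N theta lam beta tau + eps).

Definition Mfun (a : R) : R := (1 + a ^ 2) * Phi (- a) - a * phi a.

Definition lt_smax (delta s : R) : Prop :=
  exists a, 0 < a /\
    s < delta * ((1 - 2 / delta * Mfun a) / (1 + a ^ 2 - 2 * Mfun a)).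

Definition abspow (x p : R) : R :=
  if Req_EM_T x 0 then 0 else Rpower (Rabs x) p.

Definition in_Fp (p xi : R) (N : nat) (x : nat -> R) : Prop :=
  / INR N * sumN N (fun i => abspow (x i) p) <= Rpower xi p.

Fixpoint nnz (N : nat) (x : nat -> R) : nat :=
  match N with
  | O => O
  | S n => (nnz n x + if Req_EM_T (x n) 0 then 0 else 1)%nat
  end.

Definition in_F0 (s : R) (N : nat) (x : nat -> R) : Prop := INR (nnz N x) <= s * INR N.

(* Main.v *)
(** After completing the square, the inner minimum is a Huber function of [theta + tau z], so all
    Gaussian means below reduce to [E Z^2], [E Z^4] and [E (|Z| - a)_+^2 = 2 M(a)].

    Lower bound on [beta]. The [beta]-derivative of the inner minimum is
    [tau / 2 (min(|theta/tau + z|, lam/beta)^2 - z^2)]. Symmetrising in [z] bounds its mean below by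
    [- 3 tau (beta/lam)^2], uniformly in [theta]; so for small [beta] the potential increases in
    [beta] at every [tau], and no max-min pair can sit there.

    Upper bound on [beta]. In [tau] the inner minimum is subadditive, with slope at infinity of mean
    [- beta M(lam/beta)]. If [M(lam/beta) >= delta/2], the potential is strictly decreasing in [tau]
    and has no minimiser.

    Upper bound on [tau]. The sparsity condition (or, for [F_p], Markov's inequality) gives a point
    [beta = lam/alpha] at which the potential grows linearly in [tau] uniformly over the class. Since
    the potential is concave in [beta] and convex in [tau], a minimax argument shows that [tau_*] lies
    where the potential at [lam/alpha] does not exceed the max-min value, which is at most
    [sigma^2/2]. *)

Require Import Defs.
From Stdlib Require Import Reals Lra Lia Psatz ClassicalEpsilon FunctionalExtensionality.
From Coquelicot Require Import Coquelicot.
Open Scope R_scope.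

(** * Riemann integrals of continuous functions and the Gaussian integral *)

Definition cont (f : R -> R) : Prop := forall z, continuous f z.

Lemma cont_derive (f f' : R -> R) : (forall x, is_derive f x (f' x)) -> cont f.
Proof. intros H z. apply (ex_derive_continuous f z). exists (f' z). apply H. Qed.

Lemma cont_ex_RInt (f : R -> R) a b : cont f -> ex_RInt f a b.
Proof. intros H. apply (@ex_RInt_continuous R_CompleteNormedModule). intros; apply H. Qed.

Lemma is_RInt_cont (f : R -> R) a b : cont f -> is_RInt f a b (RInt f a b).
Proof. intros H. apply (@RInt_correct R_CompleteNormedModule). now apply cont_ex_RInt. Qed.

Lemma cont_plus f g : cont f -> cont g -> cont (fun z => f z + g z).
Proof. intros F G z. apply (continuous_plus f g); [apply F | apply G]. Qed.

Lemma cont_opp f : cont f -> cont (fun z => - f z).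
Proof. intros F z. apply (continuous_opp f); apply F. Qed.

Lemma cont_minus f g : cont f -> cont g -> cont (fun z => f z - g z).
Proof. intros F G z. apply (continuous_minus f g); [apply F | apply G]. Qed.

Lemma cont_mult f g : cont f -> cont g -> cont (fun z => f z * g z).
Proof. intros F G z. apply (continuous_mult f g); [apply F | apply G]. Qed.

Lemma cont_const c : cont (fun _ => c).
Proof. intros z. apply continuous_const. Qed.

Lemma cont_id : cont (fun z => z).
Proof. intros z. apply continuous_id. Qed.

Lemma cont_pow f n : cont f -> cont (fun z => f z ^ n).
Proof.
  intros F; induction n as [|n IH]; simpl.
  - apply cont_const.
  - now apply cont_mult.
Qed.

Lemma cont_comp f g : cont f -> cont g -> cont (fun z => f (g z)).
Proof. intros F G z. apply (continuous_comp g f); [apply G | apply F]. Qed.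

Lemma cont_abs : cont Rabs.
Proof. intros z. apply continuous_Rabs. Qed.

Lemma cont_pos_part : cont (fun z => Rmax z 0).
Proof.
  intros z. apply continuous_ext with (fun u => (u + Rabs u) * / 2).
  - intros u. unfold Rabs; destruct (Rcase_abs u); unfold Rmax; destruct (Rle_dec u 0); lra.
  - apply cont_mult; [apply cont_plus; [apply cont_id|apply cont_abs] | apply cont_const].
Qed.

Lemma is_derive_phi x : is_derive phi x (- x * phi x).
Proof.
  unfold phi. assert (0 < sqrt (2 * PI)) by (apply sqrt_lt_R0; pose proof PI_RGT_0; lra).
  auto_derive; [lra|]. cbn [pow Init.Nat.pred INR]. unfold Rdiv. field. lra.
Qed.

Lemma cont_phi : cont phi.
Proof. exact (cont_derive _ _ is_derive_phi). Qed.

Lemma phi_pos x : 0 < phi x.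
Proof.
  unfold phi. apply Rdiv_lt_0_compat; [apply exp_pos|].
  apply sqrt_lt_R0; pose proof PI_RGT_0; lra.
Qed.

Lemma phi_opp x : phi (- x) = phi x.
Proof. unfold phi. do 3 f_equal. ring. Qed.

Lemma RInt_le_cont f g a b : a <= b -> cont f -> cont g ->
  (forall z, a <= z <= b -> f z <= g z) -> RInt f a b <= RInt g a b.
Proof.
  intros ab F G H. apply RInt_le; auto using cont_ex_RInt.
  intros; apply H; lra.
Qed.

Lemma RInt_nonneg_cont f a b : a <= b -> cont f ->
  (forall z, 0 <= f z) -> 0 <= RInt f a b.
Proof.
  intros ab F H.
  replace 0 with (RInt (fun _ => 0) a b).
  - apply RInt_le_cont; auto using cont_const.
  - rewrite RInt_const. unfold scal; simpl; unfold mult; simpl; ring.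
Qed.

Lemma RInt_derive_cont f f' a b : (forall x, is_derive f x (f' x)) -> cont f' ->
  RInt f' a b = f b - f a.
Proof.
  intros H C. apply is_RInt_unique. apply (is_RInt_derive f f'); intros; [apply H|apply C].
Qed.

Lemma RInt_chasles f a b c : cont f -> RInt f a c = RInt f a b + RInt f b c.
Proof. intros F. symmetry. apply (RInt_Chasles f a b c); now apply cont_ex_RInt. Qed.

Lemma RInt_lin f g c d a b : cont f -> cont g ->
  RInt (fun z => c * f z + d * g z) a b = c * RInt f a b + d * RInt g a b.
Proof.
  intros F G. apply is_RInt_unique.
  apply (is_RInt_plus (fun z => c * f z) (fun z => d * g z)).
  - apply (is_RInt_scal f a b c), is_RInt_cont, F.
  - apply (is_RInt_scal g a b d), is_RInt_cont, G.
Qed.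

Lemma RInt_mirror f a b : cont f -> RInt (fun z => f (- z)) a b = RInt f (- b) (- a).
Proof.
  intros F.
  rewrite <- (opp_RInt_swap f (- a) (- b)) by now apply cont_ex_RInt.
  apply is_RInt_unique.
  apply (is_RInt_ext (fun z => opp (opp (f (- z))))).
  - intros z _. apply opp_opp.
  - apply (is_RInt_opp (fun z => opp (f (- z))) a b (RInt f (- a) (- b))).
    apply (is_RInt_comp_opp f a b (RInt f (- a) (- b))), is_RInt_cont, F.
Qed.

Definition gpart (x : R) : R := RInt (fun t => exp (- t ^ 2)) 0 x.
Definition gpar (x : R) : R := RInt (fun t => exp (- x ^ 2 * (1 + t ^ 2)) / (1 + t ^ 2)) 0 1.

Lemma cont_gauss c : cont (fun t => exp (- c * t ^ 2)).
Proof. apply cont_derive with (fun t => - c * (2 * t) * exp (- c * t ^ 2)). intros x. auto_derive; [trivial|]. simpl; ring. Qed.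

Lemma is_derive_gpart x : is_derive gpart x (exp (- x ^ 2)).
Proof.
  apply (is_derive_RInt (fun t => exp (- t ^ 2)) gpart 0 x).
  - exists posreal_one. intros y _. apply is_RInt_cont.
    intros z. apply continuous_ext with (fun t => exp (- 1 * t ^ 2)); [intros; f_equal; ring | apply cont_gauss].
  - apply continuous_ext with (fun t => exp (- 1 * t ^ 2)); [intros; f_equal; ring | apply cont_gauss].
Qed.

(** Differentiating under the integral sign cancels the denominator; the exponential then splits off
    [exp (- x ^ 2)], and the substitution [u = x t] turns what remains into [gpart x]. *)
Lemma is_derive_gpar x : is_derive gpar x (- 2 * exp (- x ^ 2) * gpart x).
Proof.
  assert (D : forall y t, is_derive (fun u => exp (- u ^ 2 * (1 + t ^ 2)) / (1 + t ^ 2)) y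
               (- 2 * y * exp (- y ^ 2 * (1 + t ^ 2)))).
  { intros y t. auto_derive; [trivial|]. simpl. field. nra. }
  assert (Ct : forall y, cont (fun t => exp (- y ^ 2 * (1 + t ^ 2)) / (1 + t ^ 2))).
  { intros y. apply cont_derive with
     (fun t => (- y ^ 2 * (2 * t) * exp (- y ^ 2 * (1 + t ^ 2)) * (1 + t ^ 2)
                - exp (- y ^ 2 * (1 + t ^ 2)) * (2 * t)) / (1 + t ^ 2) ^ 2).
    intros t. auto_derive; [nra|]. simpl. field. nra. }
  assert (E : is_derive gpar x (RInt (fun t => Derive (fun u => exp (- u ^ 2 * (1 + t ^ 2)) / (1 + t ^ 2)) x) 0 1)).
  { apply (is_derive_RInt_param (fun u t => exp (- u ^ 2 * (1 + t ^ 2)) / (1 + t ^ 2)) 0 1 x).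
    - exists posreal_one. intros y _ t _. eexists; apply D.
    - intros t _.
      apply continuity_2d_pt_ext with (fun u v => - 2 * u * exp (- u ^ 2 * (1 + v ^ 2))).
      { intros u v. symmetry. apply is_derive_unique, D. }
      apply continuity_2d_pt_mult.
      + apply continuity_2d_pt_mult; [apply continuity_2d_pt_const | apply continuity_2d_pt_id1].
      + apply (continuity_1d_2d_pt_comp exp (fun u v => - u ^ 2 * (1 + v ^ 2))).
        * apply derivable_continuous_pt, derivable_pt_exp.
        * apply continuity_2d_pt_ext with (fun u v => (- (u * u)) * (1 + v * v)).
          { intros; ring. }
          apply continuity_2d_pt_mult.
          -- apply continuity_2d_pt_opp, continuity_2d_pt_mult; apply continuity_2d_pt_id1.
          -- apply continuity_2d_pt_plus; [apply continuity_2d_pt_const|].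
             apply continuity_2d_pt_mult; apply continuity_2d_pt_id2.
    - exists posreal_one. intros y _. apply cont_ex_RInt, Ct. }
  replace (- 2 * exp (- x ^ 2) * gpart x) with
    (RInt (fun t => Derive (fun u => exp (- u ^ 2 * (1 + t ^ 2)) / (1 + t ^ 2)) x) 0 1); [exact E|].
  rewrite (RInt_ext _ (fun t => (- 2 * exp (- x ^ 2)) * (x * exp (- (x * t + 0) ^ 2)))).
  - assert (Ec : cont (fun t => exp (- t ^ 2))).
    { intros z. apply continuous_ext with (fun t => exp (- 1 * t ^ 2)); [intros; f_equal; ring | apply cont_gauss]. }
    assert (S := RInt_comp_lin (fun t => exp (- t ^ 2)) x 0 0 1).
    rewrite Rmult_0_r, Rmult_1_r, !Rplus_0_r in S.
    specialize (S (cont_ex_RInt _ _ _ Ec)).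
    unfold gpart. rewrite <- S.
    apply is_RInt_unique.
    apply (is_RInt_scal (fun t => x * exp (- (x * t + 0) ^ 2))).
    apply is_RInt_cont, cont_mult; [apply cont_const|].
    apply (cont_comp (fun t => exp (- t ^ 2)) (fun t => x * t + 0) Ec).
    apply cont_plus; [apply cont_mult; [apply cont_const|apply cont_id]|apply cont_const].
  - intros t _. refine (eq_trans (is_derive_unique _ _ _ (D x t)) _).
    replace (- x ^ 2 * (1 + t ^ 2)) with (- x ^ 2 + - (x * t + 0) ^ 2) by ring.
    rewrite exp_plus. ring.
Qed.

Lemma gpar_0 : gpar 0 = PI / 4.
Proof.
  unfold gpar. rewrite <- atan_1.
  replace (atan 1) with (atan 1 - atan 0) by (rewrite atan_0; ring).
  apply is_RInt_unique, (is_RInt_ext (fun t => / (1 + t ^ 2))).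
  - intros t _. replace (- 0 ^ 2 * (1 + t ^ 2)) with 0 by ring. rewrite exp_0. unfold Rdiv; now rewrite Rmult_1_l.
  - apply (is_RInt_derive atan (fun t => / (1 + t ^ 2))).
    + intros t _. apply is_derive_Reals.
      apply derivable_pt_lim_atan.
    + intros t _. apply (cont_derive (fun t => / (1 + t ^ 2)) (fun t => - (2 * t) / (1 + t ^ 2) ^ 2)).
      intros u. auto_derive; [nra|]. simpl. field. nra.
Qed.

(* The function [gpart ^ 2 + gpar] has zero derivative, so it is constantly [PI / 4]. *)
Lemma gpart_sqr_le x : 0 <= x -> gpart x ^ 2 <= PI / 4.
Proof.
  intros Hx.
  assert (D : forall y, is_derive (fun y => gpart y ^ 2 + gpar y) y 0).
  { intros y. pose proof (is_derive_gpart y). pose proof (is_derive_gpar y).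
    auto_derive.
    - repeat split; eexists; eassumption.
    - assert (E1 : Derive (fun x : R => gpart x) y = exp (- y ^ 2)) by (apply is_derive_unique; exact H).
      assert (E2 : Derive (fun x : R => gpar x) y = - 2 * exp (- y ^ 2) * gpart y) by (apply is_derive_unique; exact H0).
      rewrite E1, E2. simpl. ring. }
  assert (E := RInt_derive_cont _ (fun _ => 0) 0 x D (cont_const 0)).
  rewrite RInt_const in E. unfold scal in E; simpl in E; unfold mult in E; simpl in E.
  rewrite gpar_0 in E.
  assert (P : 0 <= gpar x).
  { apply RInt_ge_0; [lra| |].
    - apply cont_ex_RInt. 
      apply cont_derive with
     (fun t => (- x ^ 2 * (2 * t) * exp (- x ^ 2 * (1 + t ^ 2)) * (1 + t ^ 2)
                - exp (- x ^ 2 * (1 + t ^ 2)) * (2 * t)) / (1 + t ^ 2) ^ 2).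
      intros t. auto_derive; [nra|]. simpl. field. nra.
    - intros t _. apply Rlt_le, Rdiv_lt_0_compat; [apply exp_pos|nra]. }
  assert (Z : gpart 0 = 0) by (unfold gpart; rewrite RInt_point; reflexivity).
  rewrite Z in E. simpl in *. lra.
Qed.

(** By evenness and the substitution [t = z / sqrt 2] the integral is [2 gpart / sqrt PI], and
    [gpart <= sqrt PI / 2]. The moment bounds below are one-sided and all rest on this estimate. *)
Lemma RInt_phi_le A : 0 <= A -> RInt phi (- A) A <= 1.
Proof.
  intros HA.
  rewrite (RInt_chasles phi (-A) 0 A cont_phi).
  assert (E : RInt phi (- A) 0 = RInt phi 0 A).
  { replace 0 with (- 0) at 1 by ring. rewrite <- (RInt_mirror phi 0 A cont_phi).
    apply RInt_ext. intros; apply phi_opp. }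
  rewrite E. clear E.
  pose proof PI_RGT_0 as HP.
  assert (H2 : 0 < sqrt 2) by (apply sqrt_lt_R0; lra).
  assert (HPs : 0 < sqrt PI) by (apply sqrt_lt_R0; lra).
  assert (Ec : cont (fun t => exp (- t ^ 2))).
  { intros z. apply continuous_ext with (fun t => exp (- 1 * t ^ 2)); [intros; f_equal; ring | apply cont_gauss]. }
  assert (E : RInt phi 0 A = / sqrt PI * gpart (/ sqrt 2 * A)).
  { unfold gpart.
    assert (S := RInt_comp_lin (fun t => exp (- t ^ 2)) (/ sqrt 2) 0 0 A).
    rewrite Rmult_0_r, !Rplus_0_r in S.
    rewrite <- S by now apply cont_ex_RInt.
    apply is_RInt_unique.
    apply (is_RInt_ext (fun y => scal (/ sqrt PI) (/ sqrt 2 * exp (- (/ sqrt 2 * y + 0) ^ 2)))).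
    - intros y _. unfold scal; simpl; unfold mult; simpl. unfold phi.
      rewrite sqrt_mult by lra.
      replace (- (y ^ 2) / 2) with (- ((/ sqrt 2 * y + 0) * ((/ sqrt 2 * y + 0) * 1))).
      + field. lra.
      + replace 2 with (sqrt 2 * sqrt 2) at 3 by (apply sqrt_sqrt; lra). field. lra.
    - apply (is_RInt_scal (fun y => / sqrt 2 * exp (- (/ sqrt 2 * y + 0) ^ 2)) 0 A (/ sqrt PI)).
      apply is_RInt_cont, cont_mult; [apply cont_const|].
      apply (cont_comp (fun t => exp (- t ^ 2)) (fun t => / sqrt 2 * t + 0) Ec).
      apply cont_plus; [apply cont_mult; [apply cont_const|apply cont_id]|apply cont_const]. }
  rewrite E.
  assert (Hx : 0 <= / sqrt 2 * A).
  { apply Rmult_le_pos; [apply Rlt_le, Rinv_0_lt_compat|]; lra. }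
  pose proof (gpart_sqr_le _ Hx) as G.
  set (g := gpart (/ sqrt 2 * A)) in *.
  assert (HS : sqrt PI * sqrt PI = PI) by (apply sqrt_sqrt; lra).
  assert (g <= sqrt PI / 2) by nra.
  apply Rmult_le_reg_l with (sqrt PI); [lra|].
  replace (sqrt PI * (/ sqrt PI * g + / sqrt PI * g)) with (2 * g) by (field; lra). lra.
Qed.

(** * Gaussian expectations *)

Lemma RInt_ext_R (f g : R -> R) a b : (forall z, f z = g z) -> RInt f a b = RInt g a b.
Proof. intros E. now replace g with f by (apply functional_extensionality, E). Qed.

Lemma RInt_const_R c a b : RInt (fun _ => c) a b = c * (b - a).
Proof. rewrite RInt_const. unfold scal; simpl; unfold mult; simpl. ring. Qed.

(** Passes from integrals that carry integrability proofs to limits of the total function [RInt]. *)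
Lemma ImpInt_to_is_lim f lo hi v : cont f ->
  (ImpInt_to f lo hi v <-> is_lim (fun a => RInt f (lo a) (hi a)) p_infty v).
Proof.
  intros F. rewrite <- is_lim_spec. split.
  - intros H eps. destruct (H eps (cond_pos eps)) as [A HA]. exists A. intros a Ha.
    destruct (HA a (Rlt_le _ _ Ha)) as [pr Hpr]. now rewrite (RInt_Reals _ _ _ pr).
  (* Neighbourhoods of [p_infty] are strict, [M < a], while [ImpInt_to] asks for [A <= a]; hence
     [M + 1]. *)
  - intros H eps Heps. destruct (H (mkposreal eps Heps)) as [M HM]. exists (M + 1). intros a Ha.
    exists (ex_RInt_Reals_0 _ _ _ (cont_ex_RInt f _ _ F)).
    rewrite <- RInt_Reals. apply HM. lra.
Qed.

Lemma incr_bounded_is_lim (F : R -> R) B :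
  (forall x y, 0 <= x <= y -> F x <= F y) -> (forall x, 0 <= x -> F x <= B) ->
  exists v : R, is_lim F p_infty v.
Proof.
  intros M H.
  destruct (completeness (fun y => exists x, 0 <= x /\ y = F x)) as [v [U L]].
  - exists B. intros y [x [Hx ->]]. auto.
  - exists (F 0), 0. split; [lra|reflexivity].
  - exists v. apply is_lim_spec. intros eps. pose proof (cond_pos eps) as He.
    destruct (Classical_Prop.classic (exists x, 0 <= x /\ v - eps < F x)) as [[x [Hx Hv]]|N].
    + exists x. intros y Hy. pose proof (M x y ltac:(lra)).
      assert (F y <= v) by (apply U; exists y; split; [lra|reflexivity]).
      apply Rabs_def1; lra.
    + exfalso. assert (v <= v - eps); [|lra].
      apply L. intros y [x [Hx ->]]. apply Rnot_lt_le. intros K. apply N. eauto.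
Qed.

Lemma RInt_sym_incr f x y : cont f -> (forall z, 0 <= f z) -> 0 <= x <= y ->
  RInt f (- x) x <= RInt f (- y) y.
Proof.
  intros C P H.
  rewrite (RInt_chasles f (- y) (- x) y C), (RInt_chasles f (- x) x y C).
  pose proof (RInt_nonneg_cont f (- y) (- x) ltac:(lra) C P).
  pose proof (RInt_nonneg_cont f x y ltac:(lra) C P). lra.
Qed.

(** The primitive [- z phi z] of [(z ^ 2 - 1) phi z] contributes the boundary term
    [- 2 A phi A <= 0]. *)
Lemma phi_moment2 A : 0 <= A -> RInt (fun z => z ^ 2 * phi z) (- A) A <= RInt phi (- A) A.
Proof.
  intros HA.
  assert (C : cont (fun z => z ^ 2 * phi z)) by (apply cont_mult; [apply cont_pow, cont_id|apply cont_phi]).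
  assert (E := RInt_derive_cont (fun z => - z * phi z) (fun z => 1 * (z ^ 2 * phi z) + (- 1) * phi z) (- A) A).
  rewrite (RInt_lin (fun z => z ^ 2 * phi z) phi) in E by (exact C || exact cont_phi).
  rewrite phi_opp in E.
  assert (0 <= A * phi A) by (pose proof (phi_pos A); nra).
  enough (1 * RInt (fun z : R => z ^ 2 * phi z) (- A) A + -1 * RInt phi (- A) A = - A * phi A - - - A * phi A) by lra.
  apply E.
  - intros x. pose proof (is_derive_phi x). auto_derive.
    + eexists; eassumption.
    + assert (E1 : Derive (fun x : R => phi x) x = - x * phi x) by (apply is_derive_unique; assumption).
      rewrite E1. simpl; ring.
  - apply cont_plus; apply cont_mult; auto using cont_const, cont_phi.
Qed.

(** Same integration by parts, with the primitive [- z ^ 3 phi z] of [(z ^ 4 - 3 z ^ 2) phi z]. *)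
Lemma phi_moment4 A : 0 <= A ->
  RInt (fun z => z ^ 4 * phi z) (- A) A <= 3 * RInt (fun z => z ^ 2 * phi z) (- A) A.
Proof.
  intros HA.
  assert (C : forall n, cont (fun z => z ^ n * phi z)).
  { intros n. apply cont_mult; [apply cont_pow, cont_id|apply cont_phi]. }
  assert (E := RInt_derive_cont (fun z => - z ^ 3 * phi z) (fun z => 1 * (z ^ 4 * phi z) + (- 3) * (z ^ 2 * phi z)) (- A) A).
  rewrite (RInt_lin (fun z => z ^ 4 * phi z) (fun z => z ^ 2 * phi z)) in E by apply C.
  rewrite phi_opp in E.
  assert (0 <= A ^ 3 * phi A) by (pose proof (phi_pos A); apply Rmult_le_pos; [apply pow_le|]; lra).
  enough (1 * RInt (fun z : R => z ^ 4 * phi z) (- A) A + -3 * RInt (fun z : R => z ^ 2 * phi z) (- A) A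
      = - A ^ 3 * phi A - - (- A) ^ 3 * phi A).
  { replace (- - (- A) ^ 3 * phi A) with (- (A ^ 3 * phi A)) in * by ring.
    replace ((- (- A) ^ 3 * phi A)) with ((A ^ 3 * phi A)) in * by ring. lra. }
  apply E.
  - intros x. pose proof (is_derive_phi x). auto_derive.
    + eexists; eassumption.
    + assert (E1 : Derive (fun x : R => phi x) x = - x * phi x) by (apply is_derive_unique; assumption).
      rewrite E1. simpl; ring.
  - apply cont_plus; apply cont_mult; auto using cont_const.
Qed.

Lemma phi_weight_moment A : 0 <= A -> RInt (fun z => (1 + z ^ 4) * phi z) (- A) A <= 4.
Proof.
  intros HA.
  pose proof (RInt_phi_le A HA). pose proof (phi_moment2 A HA). pose proof (phi_moment4 A HA).
  rewrite (RInt_ext_R _ (fun z => 1 * phi z + 1 * (z ^ 4 * phi z))) by (intros; ring).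
  rewrite (RInt_lin phi (fun z => z ^ 4 * phi z)).
  - lra.
  - apply cont_phi.
  - apply cont_mult; [apply cont_pow, cont_id|apply cont_phi].
Qed.

(** Quartic growth covers every integrand below and is controlled by the fourth moment, so the
    choice operator in [gauss_E] returns a genuine limit. *)
Definition admissible (g : R -> R) : Prop :=
  cont g /\ exists C, forall z, Rabs (g z) <= C * (1 + z ^ 4).

Lemma adm_cont_phi g : admissible g -> cont (fun z => g z * phi z).
Proof. intros [G _]. apply cont_mult; [exact G|apply cont_phi]. Qed.

(** It suffices that some limit exists. Adding [C (1 + z ^ 4)] makes the integrand nonnegative, so
    its truncated integrals increase and stay bounded; the limit of the added weight is then
    subtracted. *)
Lemma gauss_E_is_lim g : admissible g ->
  is_lim (fun a => RInt (fun z => g z * phi z) (- a) a) p_infty (gauss_E g).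
Proof.
  intros Hg. assert (Cg := adm_cont_phi g Hg). destruct Hg as [G [C HC]].
  enough (H : exists v, ImpInt_to (fun z => g z * phi z) (fun a => - a) (fun a => a) v).
  { apply (proj1 (ImpInt_to_is_lim _ (fun a => - a) (fun a => a) _ Cg)).
    unfold gauss_E. now apply epsilon_spec. }
  assert (P4 : forall z, 0 <= z ^ 4) by (intros; nra).
  assert (C4 : cont (fun z => (1 + z ^ 4) * phi z)).
  { apply cont_mult; [apply cont_plus; [apply cont_const|apply cont_pow, cont_id]|apply cont_phi]. }
  destruct (incr_bounded_is_lim (fun a => RInt (fun z => (1 + z ^ 4) * phi z) (- a) a) 4) as [v4 L4].
  { intros. apply RInt_sym_incr; auto. intros z. pose proof (phi_pos z). specialize (P4 z). nra. }
  { apply phi_weight_moment. }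
  (* The bound [8 * C] comes from [g + C (1 + z ^ 4) <= 2 C (1 + z ^ 4)] and the weight having
     integral at most 4. *)
  destruct (incr_bounded_is_lim (fun a => 1 * RInt (fun z => g z * phi z) (- a) a
     + C * RInt (fun z => (1 + z ^ 4) * phi z) (- a) a) (8 * C)) as [v L].
  { intros x y Hxy. rewrite <- !RInt_lin by assumption. apply RInt_sym_incr; auto.
    - apply cont_plus; apply cont_mult; auto using cont_const.
    - intros z. pose proof (phi_pos z). specialize (HC z). pose proof (Rle_abs (- g z)) as HC'. rewrite Rabs_Ropp in HC'.
      replace (1 * (g z * phi z) + C * ((1 + z ^ 4) * phi z)) with ((g z + C * (1 + z ^ 4)) * phi z) by ring.
      apply Rmult_le_pos; lra. }
  { intros x Hx. rewrite <- RInt_lin by assumption.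
    assert (0 <= C). { specialize (HC 0). pose proof (Rabs_pos (g 0)). simpl in HC. lra. }
    apply Rle_trans with (RInt (fun z => 2 * C * ((1 + z ^ 4) * phi z) + 0 * phi z) (- x) x).
    - apply RInt_le_cont; [lra| | |].
      + apply cont_plus; apply cont_mult; auto using cont_const.
      + apply cont_plus; apply cont_mult; auto using cont_const, cont_phi.
      + intros z _. pose proof (phi_pos z). specialize (HC z). pose proof (Rle_abs (g z)).
        assert (0 <= (C * (1 + z ^ 4) - g z) * phi z) by (apply Rmult_le_pos; lra). lra.
    - rewrite (RInt_lin (fun z => (1 + z ^ 4) * phi z) phi) by auto using cont_phi.
      pose proof (phi_weight_moment x Hx). nra. }
  exists (v + - C * v4). apply ImpInt_to_is_lim; [exact Cg|].
  apply is_lim_ext with (fun a => (1 * RInt (fun z => g z * phi z) (- a) a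
     + C * RInt (fun z => (1 + z ^ 4) * phi z) (- a) a) + - C * RInt (fun z => (1 + z ^ 4) * phi z) (- a) a).
  { intros; ring. }
  apply (is_lim_plus _ _ p_infty v (- C * v4)); [exact L| |reflexivity].
  apply (is_lim_scal_l _ (- C) p_infty v4 L4).
Qed.

Lemma gauss_E_eq g (v : R) : admissible g ->
  is_lim (fun a => RInt (fun z => g z * phi z) (- a) a) p_infty v -> gauss_E g = v.
Proof.
  intros Hg H. apply is_lim_unique in H.
  pose proof (is_lim_unique _ _ _ (gauss_E_is_lim g Hg)) as H'. rewrite H in H'. now injection H'.
Qed.

Lemma adm_lin g h a b : admissible g -> admissible h -> admissible (fun z => a * g z + b * h z).
Proof.
  intros [G [C HC]] [H [D HD]]. split.
  - apply cont_plus; apply cont_mult; auto using cont_const.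
  - exists (Rabs a * C + Rabs b * D). intros z.
    eapply Rle_trans; [apply Rabs_triang|]. rewrite !Rabs_mult.
    specialize (HC z); specialize (HD z). pose proof (Rabs_pos a). pose proof (Rabs_pos b). nra.
Qed.

Lemma adm_ext g h : (forall z, g z = h z) -> admissible g -> admissible h.
Proof. intros E A. now replace h with g by (apply functional_extensionality, E). Qed.

Lemma adm_mirror g : admissible g -> admissible (fun z => g (- z)).
Proof.
  intros [G [C HC]]. split.
  - apply (cont_comp g (fun z => - z) G), cont_opp, cont_id.
  - exists C. intros z. replace (z ^ 4) with ((- z) ^ 4) by ring. apply HC.
Qed.

Lemma adm_const c : admissible (fun _ => c).
Proof.
  split; [apply cont_const|]. exists (Rabs c). intros z. pose proof (Rabs_pos c).
  assert (0 <= z ^ 4) by nra. nra.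
Qed.

Lemma adm_pow n : (n <= 4)%nat -> admissible (fun z => z ^ n).
Proof.
  intros Hn. split; [apply cont_pow, cont_id|]. exists 1. intros z.
  rewrite <- RPow_abs. replace (z ^ 4) with (Rabs z ^ 4).
  2: { rewrite RPow_abs. apply Rabs_pos_eq. nra. }
  pose proof (Rabs_pos z) as P. set (y := Rabs z) in *.
  assert (0 <= y ^ 4) by (apply pow_le; lra).
  destruct (Rle_dec y 1) as [L|L].
  - assert (y ^ n <= 1) by (rewrite <- (pow1 n); apply pow_incr; lra). lra.
  - assert (y ^ n <= y ^ 4) by (apply Rle_pow; [lra|lia]). lra.
Qed.

Lemma adm_le g h : cont g -> admissible h -> (forall z, Rabs (g z) <= h z) -> admissible g.
Proof.
  intros G [_ [C HC]] H. split; [exact G|]. exists C. intros z.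
  eapply Rle_trans; [apply H|]. eapply Rle_trans; [apply Rle_abs|apply HC].
Qed.

Lemma gauss_E_lin g h a b : admissible g -> admissible h ->
  gauss_E (fun z => a * g z + b * h z) = a * gauss_E g + b * gauss_E h.
Proof.
  intros G H. apply gauss_E_eq; [now apply adm_lin|].
  apply is_lim_ext with (fun x => a * RInt (fun z => g z * phi z) (- x) x + b * RInt (fun z => h z * phi z) (- x) x).
  - intros x. rewrite <- RInt_lin by now apply adm_cont_phi. apply RInt_ext_R. intros; ring.
  - apply (is_lim_plus _ _ p_infty (a * gauss_E g) (b * gauss_E h)); [| |reflexivity].
    + apply (is_lim_scal_l _ a p_infty (gauss_E g)). now apply gauss_E_is_lim.
    + apply (is_lim_scal_l _ b p_infty (gauss_E h)). now apply gauss_E_is_lim.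
Qed.

Lemma is_lim_le_p_infty F G (u v : R) : (forall x, 0 <= x -> F x <= G x) ->
  is_lim F p_infty u -> is_lim G p_infty v -> u <= v.
Proof.
  intros H HF HG. apply (is_lim_le_loc F G p_infty u v); [|exact HF|exact HG].
  exists 0. intros; apply H; lra.
Qed.

Lemma gauss_E_le g h : admissible g -> admissible h -> (forall z, g z <= h z) ->
  gauss_E g <= gauss_E h.
Proof.
  intros G H L.
  apply (is_lim_le_p_infty _ _ _ _) with (2 := gauss_E_is_lim g G) (3 := gauss_E_is_lim h H).
  intros x Hx. apply RInt_le_cont; [lra|now apply adm_cont_phi|now apply adm_cont_phi|].
  intros z _. apply Rmult_le_compat_r; [apply Rlt_le, phi_pos|apply L].
Qed.

Lemma gauss_E_mirror g : admissible g -> gauss_E (fun z => g (- z)) = gauss_E g.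
Proof.
  intros G. apply gauss_E_eq; [now apply adm_mirror|].
  apply is_lim_ext with (2 := gauss_E_is_lim g G). intros x.
  rewrite <- (Ropp_involutive x) at 2.
  rewrite <- (RInt_mirror (fun z => g z * phi z)) by now apply adm_cont_phi.
  apply RInt_ext_R. intros z. now rewrite phi_opp.
Qed.

(** Since [Z] and [-Z] have the same law, only even parts need comparing; terms odd in [z] drop
    out. *)
Lemma gauss_E_le_sym g h : admissible g -> admissible h ->
  (forall z, g z + g (- z) <= h z + h (- z)) -> gauss_E g <= gauss_E h.
Proof.
  intros G H L.
  assert (gauss_E (fun z => 1 * g z + 1 * g (- z)) <= gauss_E (fun z => 1 * h z + 1 * h (- z))) as E.
  { apply gauss_E_le; try (apply adm_lin; auto using adm_mirror). intros z. specialize (L z). lra. }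
  rewrite (gauss_E_lin g (fun z => g (- z))), (gauss_E_lin h (fun z => h (- z))) in E by auto using adm_mirror.
  rewrite !gauss_E_mirror in E by assumption. lra.
Qed.

Lemma gauss_E_bound g c : admissible g ->
  (forall a, 0 <= a -> RInt (fun z => g z * phi z) (- a) a <= c) -> gauss_E g <= c.
Proof.
  intros G H. apply (is_lim_le_p_infty _ (fun _ => c) _ _ H (gauss_E_is_lim g G)).
  apply is_lim_const.
Qed.

Lemma gauss_E_1 : gauss_E (fun _ => 1) <= 1.
Proof.
  apply gauss_E_bound; [apply adm_const|]. intros a Ha.
  rewrite (RInt_ext_R _ phi) by (intros; ring). now apply RInt_phi_le.
Qed.

Lemma gauss_E_pow2 : gauss_E (fun z => z ^ 2) <= 1.
Proof.
  apply gauss_E_bound; [apply adm_pow; lia|]. intros a Ha.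
  pose proof (RInt_phi_le a Ha). pose proof (phi_moment2 a Ha). lra.
Qed.

Lemma gauss_E_pow4 : gauss_E (fun z => z ^ 4) <= 3.
Proof.
  apply gauss_E_bound; [apply adm_pow; lia|]. intros a Ha.
  pose proof (RInt_phi_le a Ha). pose proof (phi_moment2 a Ha). pose proof (phi_moment4 a Ha). lra.
Qed.

(** * The thresholded second moment and the function M *)

Definition excess (a z : R) : R := Rmax (Rabs z - a) 0.

Lemma excess_bounds a z : 0 <= a -> 0 <= excess a z <= Rabs z.
Proof. intros. unfold excess, Rmax. pose proof (Rabs_pos z). destruct Rle_dec; lra. Qed.

Lemma cont_excess a : cont (excess a).
Proof.
  apply (cont_comp (fun u => Rmax u 0) (fun z => Rabs z - a) cont_pos_part).
  apply cont_minus; [apply cont_abs|apply cont_const].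
Qed.

Lemma excess_sqr_le a z : 0 <= a -> excess a z ^ 2 <= z ^ 2.
Proof. intros H. pose proof (excess_bounds a z H). rewrite <- (pow2_abs z). nra. Qed.

Lemma adm_excess a : 0 <= a -> admissible (fun z => excess a z ^ 2).
Proof.
  intros H. apply (adm_le _ (fun z => z ^ 2)); [apply cont_pow, cont_excess|apply adm_pow; lia|].
  intros z. rewrite Rabs_pos_eq by apply pow2_ge_0. now apply excess_sqr_le.
Qed.

(** A crude tail bound: [exp (- u) <= 1 / u] with [u = x ^ 2 / 2], and [sqrt (2 PI) >= 1]. *)
Lemma phi_le x : 0 < x -> phi x <= 2 / x ^ 2.
Proof.
  intros Hx. unfold phi.
  assert (S : 1 <= sqrt (2 * PI)).
  { rewrite <- sqrt_1 at 1. apply sqrt_le_1; pose proof PI2_1; lra. }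
  assert (E : exp (- x ^ 2 / 2) <= 2 / x ^ 2).
  { replace (- x ^ 2 / 2) with (- (x ^ 2 / 2)) by field. rewrite exp_Ropp.
    assert (P : 0 < x ^ 2) by nra.
    pose proof (exp_ineq1 (x ^ 2 / 2) ltac:(lra)).
    replace (2 / x ^ 2) with (/ (x ^ 2 / 2)) by (field; lra).
    apply Rinv_le_contravar; lra. }
  apply Rle_trans with (2 := E).
  pose proof (exp_pos (- x ^ 2 / 2)).
  apply Rmult_le_reg_r with (sqrt (2 * PI)); [lra|].
  unfold Rdiv at 1. rewrite Rmult_assoc, Rinv_l by lra. nra.
Qed.

Lemma is_lim_phi_tail a : 0 <= a -> is_lim (fun A => (2 * a - A) * phi A) p_infty 0.
Proof.
  intros Ha. apply is_lim_spec. intros eps. pose proof (cond_pos eps) as He.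
  (* Past [2 a] the value lies between [- x phi x] and 0, and [x > 2 / eps] gives
     [x phi x <= 2 / x < eps]. *)
  exists (1 + 2 * a + 2 / eps). intros x Hx.
  assert (0 < 2 / eps) by (apply Rdiv_lt_0_compat; lra).
  pose proof (phi_le x ltac:(lra)) as P. pose proof (phi_pos x) as P0.
  assert (K : x * phi x <= 2 / x).
  { replace (2 / x) with (x * (2 / x ^ 2)) by (field; lra). apply Rmult_le_compat_l; lra. }
  assert (L : 2 / x < eps).
  { apply Rmult_lt_reg_r with (x / eps); [apply Rdiv_lt_0_compat; lra|].
    replace (2 / x * (x / eps)) with (2 / eps) by (field; lra).
    replace (eps * (x / eps)) with x by (field; lra). lra. }
  rewrite Rminus_0_r. apply Rabs_def1; nra.
Qed.

Lemma is_derive_phi_primitive a x :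
  is_derive (fun z => (2 * a - z) * phi z) x (1 * ((x - a) ^ 2 * phi x) + - (1 + a ^ 2) * phi x).
Proof.
  pose proof (is_derive_phi x). auto_derive.
  - eexists; eassumption.
  - assert (E1 : Derive (fun x : R => phi x) x = - x * phi x) by (apply is_derive_unique; assumption).
    rewrite E1. simpl; ring.
Qed.

(** The integrand vanishes between [-a] and [a] and the two tails are mirror images. On the right
    tail the primitive [(2 a - z) phi z] reduces the square to a multiple of the integral of
    [phi]. *)
Lemma RInt_excess a A : 0 <= a <= A ->
  RInt (fun z => excess a z ^ 2 * phi z) (- A) A =
  2 * ((1 + a ^ 2) * RInt phi (- A) (- a) + (2 * a - A) * phi A - a * phi a).
Proof.
  intros H.
  assert (C : cont (fun z => excess a z ^ 2 * phi z)) by (apply adm_cont_phi, adm_excess; lra).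
  assert (C' : cont (fun z => (z - a) ^ 2 * phi z)).
  { apply cont_mult; [apply cont_pow, cont_minus; [apply cont_id|apply cont_const]|apply cont_phi]. }
  rewrite (RInt_chasles _ (- A) (- a) A C), (RInt_chasles _ (- a) a A C).
  rewrite <- (RInt_mirror phi a A cont_phi).
  rewrite <- (RInt_mirror (fun z => excess a z ^ 2 * phi z) a A C).
  rewrite (RInt_ext_R (fun z => excess a (- z) ^ 2 * phi (- z)) (fun z => excess a z ^ 2 * phi z)).
  2: { intros z. unfold excess. now rewrite Rabs_Ropp, phi_opp. }
  rewrite (RInt_ext_R (fun z => phi (- z)) phi) by apply phi_opp.
  assert (E0 : RInt (fun z => excess a z ^ 2 * phi z) (- a) a = 0).
  { apply is_RInt_unique. apply (is_RInt_ext (fun _ => 0)).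
    - intros z Hz. rewrite Rmin_left, Rmax_right in Hz by lra. unfold excess.
      rewrite Rmax_right; [simpl; ring|]. apply Rle_minus, Rabs_le. lra.
    - pose proof (is_RInt_cont (fun _ => 0) (- a) a (cont_const 0)) as I.
      rewrite RInt_const_R, Rmult_0_l in I. exact I. }
  rewrite E0.
  assert (E1 : RInt (fun z => excess a z ^ 2 * phi z) a A = RInt (fun z => (z - a) ^ 2 * phi z) a A).
  { apply is_RInt_unique. apply (is_RInt_ext (fun z => (z - a) ^ 2 * phi z)).
    - intros z Hz. rewrite Rmin_left, Rmax_right in Hz by lra. unfold excess.
      rewrite Rabs_pos_eq, Rmax_left by lra. reflexivity.
    - now apply is_RInt_cont. }
  rewrite E1.
  assert (E := RInt_derive_cont _ _ a A (is_derive_phi_primitive a)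
    ltac:(apply cont_plus; apply cont_mult; auto using cont_const, cont_phi)).
  rewrite (RInt_lin (fun z => (z - a) ^ 2 * phi z) phi) in E by auto using cont_phi.
  lra.
Qed.

Lemma is_lim_Phi_opp a : 0 <= a -> is_lim (fun A => RInt phi (- A) (- a)) p_infty (Phi (- a)).
Proof.
  intros Ha.
  apply (proj1 (ImpInt_to_is_lim phi (fun A => - A) (fun _ => - a) _ cont_phi)).
  unfold Phi. apply epsilon_spec.
  destruct (incr_bounded_is_lim (fun A => RInt phi (- A) (- a)) 1) as [v Hv].
  - intros x y H. rewrite (RInt_chasles phi (- y) (- x) (- a) cont_phi).
    pose proof (RInt_nonneg_cont phi (- y) (- x) ltac:(lra) cont_phi (fun z => Rlt_le _ _ (phi_pos z))). lra.
  - intros x Hx. pose proof (RInt_phi_le x Hx) as B.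
    rewrite (RInt_chasles phi (- x) (- a) x cont_phi) in B.
    pose proof (RInt_nonneg_cont phi (- a) x ltac:(lra) cont_phi (fun z => Rlt_le _ _ (phi_pos z))). lra.
  - exists v. now apply (ImpInt_to_is_lim phi (fun A => - A) (fun _ => - a) _ cont_phi).
Qed.

Lemma gauss_E_excess a : 0 <= a -> gauss_E (fun z => excess a z ^ 2) = 2 * Mfun a.
Proof.
  intros Ha. apply gauss_E_eq; [now apply adm_excess|].
  apply (is_lim_ext_loc (fun A => 2 * ((1 + a ^ 2) * RInt phi (- A) (- a) + (2 * a - A) * phi A - a * phi a))).
  - exists a. intros A HA. symmetry. apply RInt_excess; lra.
  - replace (2 * Mfun a) with (2 * ((1 + a ^ 2) * Phi (- a) + 0 - a * phi a)) by (unfold Mfun; ring).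
    apply (is_lim_scal_l _ 2 p_infty ((1 + a ^ 2) * Phi (- a) + 0 - a * phi a)).
    apply (is_lim_minus _ _ p_infty ((1 + a ^ 2) * Phi (- a) + 0) (a * phi a)); [|apply is_lim_const|reflexivity].
    apply (is_lim_plus _ _ p_infty ((1 + a ^ 2) * Phi (- a)) 0); [|now apply is_lim_phi_tail|reflexivity].
    apply (is_lim_scal_l _ (1 + a ^ 2) p_infty (Phi (- a))). now apply is_lim_Phi_opp.
Qed.

Lemma Mfun_nonneg a : 0 <= a -> 0 <= Mfun a.
Proof.
  (* Zero is written as a trivial combination of expectations, so linearity makes it an expectation
     comparable pointwise. The same device recurs below. *)
  intros Ha. enough (0 * gauss_E (fun _ => 0) + 0 * gauss_E (fun _ => 0) <= 2 * Mfun a) by lra.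
  rewrite <- gauss_E_excess, <- gauss_E_lin by auto using adm_const.
  apply gauss_E_le; auto using adm_lin, adm_const, adm_excess.
  intros z. pose proof (pow2_ge_0 (excess a z)). lra.
Qed.

Lemma Mfun_le_half a : 0 <= a -> 2 * Mfun a <= 1.
Proof.
  intros Ha. rewrite <- gauss_E_excess by assumption. apply Rle_trans with (2 := gauss_E_pow2).
  apply gauss_E_le; [now apply adm_excess|apply adm_pow; lia|].
  intros z. now apply excess_sqr_le.
Qed.

Lemma Mfun_decr a b : 0 <= a <= b -> Mfun b <= Mfun a.
Proof.
  intros H. enough (2 * Mfun b <= 2 * Mfun a) by lra. rewrite <- !gauss_E_excess by lra.
  apply gauss_E_le; [apply adm_excess; lra..|].
  intros z. apply pow_incr. split; [apply excess_bounds; lra|].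
  unfold excess. apply Rle_max_compat_r. lra.
Qed.

(** For [y = |z| > a] one has [a (y - a) <= y ^ 2]; hence [a ^ 2] times the squared excess is at
    most [z ^ 4], whose mean is at most 3. *)
Lemma Mfun_decay a : 0 < a -> 2 * Mfun a * a ^ 2 <= 3.
Proof.
  intros Ha. rewrite <- gauss_E_excess by lra. apply Rle_trans with (2 := gauss_E_pow4).
  replace (gauss_E (fun z => excess a z ^ 2) * a ^ 2) with
    (a ^ 2 * gauss_E (fun z => excess a z ^ 2) + 0 * gauss_E (fun _ => 0)) by ring.
  rewrite <- gauss_E_lin by (apply adm_const || (apply adm_excess; lra)).
  apply gauss_E_le; [apply adm_lin; [apply adm_excess; lra|apply adm_const]|apply adm_pow; lia|].
  intros z. replace (z ^ 4) with (Rabs z ^ 4).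
  2: { rewrite RPow_abs. apply Rabs_pos_eq. nra. }
  pose proof (Rabs_pos z) as P. unfold excess, Rmax. destruct Rle_dec as [L|L].
  - rewrite pow_i by lia. assert (0 <= Rabs z ^ 4) by (apply pow_le; lra). lra.
  - set (y := Rabs z) in *. replace (a ^ 2 * (y - a) ^ 2 + 0 * 0) with ((a * (y - a)) ^ 2) by ring.
    replace (y ^ 4) with ((y * y) ^ 2) by ring. apply pow_incr. nra.
Qed.

(** * The inner minimum *)

Definition inner (lam beta tau th z w : R) : R :=
  w ^ 2 / (2 * tau) * beta - beta * z * w + lam * Rabs (w + th) - lam * Rabs th.

Definition inner_min lam beta tau th z : R := min_val (inner lam beta tau th z).

Definition risk lam beta tau th : R := gauss_E (inner_min lam beta tau th).

(* The soft threshold [eta(x; b)], as [x] minus its clipping to the interval from [-b] to [b]. *)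
Definition soft (b x : R) : R := x - (if Rle_dec (Rabs x) b then x else if Rle_dec 0 x then b else - b).

(* Completing the square in [u = w + th] turns the inner objective into
   [beta / (2 tau) (u - (th + tau z)) ^ 2 + lam |u|], whose minimum is a Huber function. *)
Definition inner_formula lam beta tau th z : R :=
  beta / (2 * tau) * ((th + tau * z) ^ 2 - excess (tau * (lam / beta)) (th + tau * z) ^ 2
    - (tau * z) ^ 2) - lam * Rabs th.

Lemma min_val_eq f m w : f w = m -> (forall w, m <= f w) -> min_val f = m.
Proof.
  intros E L. unfold min_val.
  destruct (epsilon_spec (inhabits 0) (fun m => (exists w, f w = m) /\ forall w, m <= f w)) as [[w' H'] L'].
  { exists m. eauto. }
  apply Rle_antisym; [rewrite <- E; apply L' | rewrite <- H' at 1; apply L].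
Qed.

Lemma inner_soft lam beta tau th z : 0 < lam -> 0 < beta -> 0 < tau ->
  inner lam beta tau th z (soft (tau * (lam / beta)) (th + tau * z) - th) = inner_formula lam beta tau th z.
Proof.
  intros Hl Hb Ht. unfold inner, inner_formula, soft, excess.
  set (b := tau * (lam / beta)). assert (B : 0 < b) by (unfold b; apply Rmult_lt_0_compat; [|apply Rdiv_lt_0_compat]; lra).
  (* With [lam] and [z] expressed through [b] and [x], each branch of the threshold is a rational
     identity. *)
  assert (El : lam = b * beta / tau) by (unfold b; field; lra).
  clearbody b. set (x := th + tau * z).
  assert (Ez : z = (x - th) / tau) by (unfold x; field; lra). clearbody x. subst z.
  destruct (Rle_dec (Rabs x) b) as [L|L].
  - rewrite Rmax_right by lra. replace (x - x - th + th) with 0 by ring. rewrite Rabs_R0. field. lra.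
  - rewrite Rmax_left by lra. destruct (Rle_dec 0 x) as [S|S].
    + rewrite (Rabs_pos_eq x) in * by lra. replace (x - b - th + th) with (x - b) by ring.
      rewrite (Rabs_pos_eq (x - b)) by lra. rewrite El. field. lra.
    + rewrite (Rabs_left x) in * by lra. replace (x - - b - th + th) with (x + b) by ring.
      rewrite (Rabs_left (x + b)) by lra. rewrite El. field. lra.
Qed.

(** As [u x <= |u| |x|], the gap is, up to a positive factor, at least [|u| ^ 2 - 2 |u| (|x| - b)]
    plus the squared excess of [x]: a perfect square if [|x| > b], a sum of nonnegative terms
    otherwise. *)
Lemma inner_formula_le lam beta tau th z w : 0 < lam -> 0 < beta -> 0 < tau ->
  inner_formula lam beta tau th z <= inner lam beta tau th z w.
Proof.
  intros Hl Hb Ht. unfold inner, inner_formula, excess.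
  set (b := tau * (lam / beta)). assert (B : 0 < b) by (unfold b; apply Rmult_lt_0_compat; [|apply Rdiv_lt_0_compat]; lra).
  assert (El : lam = b * beta / tau) by (unfold b; field; lra).
  clearbody b. set (x := th + tau * z).
  assert (Ez : z = (x - th) / tau) by (unfold x; field; lra). clearbody x. subst z.
  set (u := w + th). assert (Ew : w = u - th) by (unfold u; ring). clearbody u. subst w.
  apply Rminus_le_0.
  replace (_ - _) with (beta / (2 * tau) * ((u - x) ^ 2 + 2 * b * Rabs u - x ^ 2 + Rmax (Rabs x - b) 0 ^ 2))
    by (rewrite El; field; lra).
  apply Rmult_le_pos; [apply Rlt_le, Rdiv_lt_0_compat; lra|].
  assert (M : u * x <= Rabs u * Rabs x) by (rewrite <- Rabs_mult; apply Rle_abs).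
  pose proof (Rabs_pos u). rewrite <- (pow2_abs x), <- (pow2_abs (u - x)), pow2_abs.
  replace ((u - x) ^ 2) with (Rabs u ^ 2 - 2 * (u * x) + Rabs x ^ 2) by (rewrite !pow2_abs; ring).
  unfold Rmax. destruct Rle_dec as [L|L].
  - nra.
  - pose proof (pow2_ge_0 (Rabs u - (Rabs x - b))). nra.
Qed.

Lemma inner_min_formula lam beta tau th z : 0 < lam -> 0 < beta -> 0 < tau ->
  inner_min lam beta tau th z = inner_formula lam beta tau th z.
Proof.
  intros. eapply min_val_eq; [now apply inner_soft|]. intros; now apply inner_formula_le.
Qed.

Lemma inner_min_beta0 lam tau th z : 0 < lam -> 0 < tau -> inner_min lam 0 tau th z = - lam * Rabs th.
Proof.
  intros. apply min_val_eq with (- th); unfold inner.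
  - rewrite Rplus_opp_l, Rabs_R0. field. lra.
  - intros w. replace (w ^ 2 / (2 * tau) * 0) with 0 by (field; lra). pose proof (Rabs_pos (w + th)). nra.
Qed.

(** Supplies a minimiser that later serves, via [inner_min_le], as a competitor at other
    parameters. *)
Lemma inner_min_attained lam beta tau th z : 0 < lam -> 0 <= beta -> 0 < tau ->
  exists w, inner_min lam beta tau th z = inner lam beta tau th z w.
Proof.
  intros Hl [Hb|<-] Ht.
  - rewrite inner_min_formula by assumption. eexists. symmetry. now apply inner_soft.
  - rewrite inner_min_beta0 by assumption. exists (- th). unfold inner. rewrite Rplus_opp_l, Rabs_R0. field. lra.
Qed.

Lemma inner_min_le lam beta tau th z w : 0 < lam -> 0 <= beta -> 0 < tau ->
  inner_min lam beta tau th z <= inner lam beta tau th z w.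
Proof.
  intros Hl [Hb|<-] Ht.
  - rewrite inner_min_formula by assumption. now apply inner_formula_le.
  - rewrite inner_min_beta0 by assumption. unfold inner.
    replace (w ^ 2 / (2 * tau) * 0) with 0 by (field; lra). pose proof (Rabs_pos (w + th)). nra.
Qed.

Lemma adm_sqr_affine a b : admissible (fun z => (a + b * z) ^ 2).
Proof.
  apply (adm_ext (fun z => 1 * (a ^ 2 * 1 + (2 * a * b) * z ^ 1) + b ^ 2 * z ^ 2)); [intros; simpl; ring|].
  apply adm_lin; [apply adm_lin; [apply adm_const|]|]; apply adm_pow; lia.
Qed.

(** For [beta > 0] the closed form is a combination of squares of affine functions of [z], a
    constant, and a squared excess dominated by such a square. *)
Lemma adm_inner_min lam beta tau th : 0 < lam -> 0 <= beta -> 0 < tau ->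
  admissible (inner_min lam beta tau th).
Proof.
  intros Hl [Hb|<-] Ht.
  - apply (adm_ext (inner_formula lam beta tau th)); [intros; symmetry; now apply inner_min_formula|].
    unfold inner_formula. set (b := tau * (lam / beta)).
    assert (B : 0 < b) by (unfold b; apply Rmult_lt_0_compat; [|apply Rdiv_lt_0_compat]; lra). clearbody b.
    set (c := beta / (2 * tau)).
    apply (adm_ext (fun z => 1 * (c * (th + tau * z) ^ 2 + (- c) * excess b (th + tau * z) ^ 2)
        + 1 * ((- c) * (0 + tau * z) ^ 2 + (- lam * Rabs th) * 1))).
    { intros z. replace (0 + tau * z) with (tau * z) by ring. ring. }
    apply adm_lin; apply adm_lin; [apply adm_sqr_affine| |apply adm_sqr_affine|apply adm_const].
    apply adm_le with (fun z => (th + tau * z) ^ 2); [|apply adm_sqr_affine|].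
    + apply (cont_comp (fun x => excess b x ^ 2) (fun z => th + tau * z)).
      * apply cont_pow, cont_excess.
      * apply cont_plus; [apply cont_const|apply cont_mult; [apply cont_const|apply cont_id]].
    + intros z. rewrite Rabs_pos_eq by apply pow2_ge_0. apply excess_sqr_le; lra.
  - apply (adm_ext (fun _ => - lam * Rabs th)); [intros; symmetry; now apply inner_min_beta0|].
    apply adm_const.
Qed.

Ltac adm := repeat lazymatch goal with
  | |- admissible (inner_min _ _ _ _) => apply adm_inner_min
  | |- admissible (fun z => inner_min _ _ _ _ z) => apply adm_inner_min
  | |- admissible (fun z => _ * _ + _ * _) => apply adm_lin
  | |- admissible (fun z => excess _ z ^ 2) => apply adm_excess
  | |- admissible (fun z => z ^ _) => apply adm_pow; lia
  | |- admissible (fun _ => ?c) => apply (adm_const c)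
  end; try lra.

(** * Convexity, growth and lower bounds for the mean inner minimum *)

Lemma risk_nonpos lam beta tau th : 0 < lam -> 0 <= beta -> 0 < tau -> risk lam beta tau th <= 0.
Proof.
  intros. replace 0 with (0 * gauss_E (fun _ => 0) + 0 * gauss_E (fun _ => 0)) by ring.
  rewrite <- gauss_E_lin by adm. unfold risk. apply gauss_E_le; [adm..|].
  intros z. eapply Rle_trans; [apply (inner_min_le _ _ _ _ _ 0); assumption|].
  unfold inner. rewrite Rplus_0_l. right. field. lra.
Qed.

(** For fixed [w] the inner objective is affine in [beta], and a minimum of affine functions is
    concave. *)
Lemma risk_concave_beta lam b1 b2 tau th t : 0 < lam -> 0 <= b1 -> 0 <= b2 -> 0 < tau -> 0 <= t <= 1 ->
  (1 - t) * risk lam b1 tau th + t * risk lam b2 tau th <= risk lam ((1 - t) * b1 + t * b2) tau th.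
Proof.
  intros. assert (0 <= (1 - t) * b1 + t * b2) by nra.
  unfold risk. rewrite <- gauss_E_lin by adm. apply gauss_E_le; [adm..|]. intros z.
  destruct (inner_min_attained lam ((1 - t) * b1 + t * b2) tau th z) as [w E]; try assumption.
  rewrite E. pose proof (inner_min_le lam b1 tau th z w ltac:(lra) ltac:(lra) ltac:(lra)).
  pose proof (inner_min_le lam b2 tau th z w ltac:(lra) ltac:(lra) ltac:(lra)).
  replace (inner lam ((1 - t) * b1 + t * b2) tau th z w) with
   ((1 - t) * inner lam b1 tau th z w + t * inner lam b2 tau th z w) by (unfold inner; ring).
  apply Rplus_le_compat; apply Rmult_le_compat_l; lra.
Qed.

Lemma perspective_subadd x y s t : 0 < s -> 0 < t ->
  (x + y) ^ 2 / (s + t) <= x ^ 2 / s + y ^ 2 / t.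
Proof.
  intros Hs Ht. apply Rminus_le_0.
  replace (_ - _) with ((x * t - y * s) ^ 2 / (s * t * (s + t))) by (field; lra).
  apply Rmult_le_pos; [apply pow2_ge_0|]. apply Rlt_le, Rinv_0_lt_compat.
  repeat apply Rmult_lt_0_compat; lra.
Qed.

(** The inner objective is jointly convex in [(tau, w)], so the midpoint of the two minimisers is a
    good enough competitor at the middle [tau]. *)
Lemma risk_midconvex_tau lam beta t1 t2 th : 0 < lam -> 0 <= beta -> 0 < t1 -> 0 < t2 ->
  2 * risk lam beta ((t1 + t2) / 2) th <= risk lam beta t1 th + risk lam beta t2 th.
Proof.
  intros. enough (2 * risk lam beta ((t1 + t2) / 2) th + 0 * risk lam beta t1 th
    <= 1 * risk lam beta t1 th + 1 * risk lam beta t2 th) by lra.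
  unfold risk. rewrite <- !gauss_E_lin by adm. apply gauss_E_le; [adm..|]. intros z.
  destruct (inner_min_attained lam beta t1 th z) as [w1 E1]; try assumption.
  destruct (inner_min_attained lam beta t2 th z) as [w2 E2]; try assumption.
  rewrite Rmult_0_l, Rplus_0_r, E1, E2.
  pose proof (inner_min_le lam beta ((t1 + t2) / 2) th z ((w1 + w2) / 2) ltac:(lra) ltac:(lra) ltac:(lra)) as L.
  apply Rle_trans with (2 * inner lam beta ((t1 + t2) / 2) th z ((w1 + w2) / 2)); [lra|].
  unfold inner.
  pose proof (perspective_subadd w1 w2 t1 t2 ltac:(lra) ltac:(lra)) as P.
  assert (2 * Rabs ((w1 + w2) / 2 + th) <= Rabs (w1 + th) + Rabs (w2 + th)) as A.
  { rewrite <- (Rabs_pos_eq 2) at 1 by lra. rewrite <- Rabs_mult.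
    replace (2 * ((w1 + w2) / 2 + th)) with ((w1 + th) + (w2 + th)) by field. apply Rabs_triang. }
  replace (((w1 + w2) / 2) ^ 2 / (2 * ((t1 + t2) / 2))) with (/ 4 * ((w1 + w2) ^ 2 / (t1 + t2))) by (field; lra).
  replace (w1 ^ 2 / (2 * t1)) with (/ 2 * (w1 ^ 2 / t1)) by (field; lra).
  replace (w2 ^ 2 / (2 * t2)) with (/ 2 * (w2 ^ 2 / t2)) by (field; lra).
  apply Rmult_le_compat_l with (r := beta) in P; [|lra].
  apply Rmult_le_compat_l with (r := lam) in A; [|lra]. lra.
Qed.

(* The inner objective at [th = 0] is jointly homogeneous in [(tau, w)], so adding its minimiser
   at [tau = s] to the minimiser at [tau] gives a competitor at [tau + s]. *)
Lemma risk_add_tau lam beta tau s th : 0 < lam -> 0 < beta -> 0 < tau -> 0 < s ->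
  risk lam beta (tau + s) th <= risk lam beta tau th - s * beta * Mfun (lam / beta).
Proof.
  intros. assert (Ha : 0 < lam / beta) by (apply Rdiv_lt_0_compat; lra).
  replace (risk lam beta tau th - s * beta * Mfun (lam / beta)) with
    (1 * risk lam beta tau th + (- s * beta / 2) * (2 * Mfun (lam / beta))) by field.
  rewrite <- gauss_E_excess by lra.
  unfold risk. rewrite <- gauss_E_lin by adm. apply gauss_E_le; [adm..|]. intros z.
  destruct (inner_min_attained lam beta tau th z) as [w E]; try lra.
  pose proof (inner_soft lam beta s 0 z ltac:(lra) ltac:(lra) ltac:(lra)) as E0.
  set (v := soft (s * (lam / beta)) (0 + s * z) - 0) in E0.
  rewrite E.
  eapply Rle_trans; [apply (inner_min_le _ _ _ _ _ (w + v)); lra|].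
  (* At [th = 0] the terms in [z ^ 2] cancel and the excess scales linearly in [s]. *)
  replace (- s * beta / 2 * excess (lam / beta) z ^ 2) with (inner_formula lam beta s 0 z).
  2: { unfold inner_formula. rewrite Rabs_R0.
       replace (excess (s * (lam / beta)) (0 + s * z)) with (s * excess (lam / beta) z).
       - field. lra.
       - unfold excess. rewrite Rplus_0_l, Rabs_mult, (Rabs_pos_eq s) by lra.
         rewrite <- RmaxRmult by lra. f_equal; ring. }
  rewrite <- E0. unfold inner. rewrite Rabs_R0, !Rplus_0_r.
  pose proof (perspective_subadd w v tau s ltac:(lra) ltac:(lra)) as P.
  assert (Rabs (w + v + th) <= Rabs (w + th) + Rabs v) as A.
  { replace (w + v + th) with ((w + th) + v) by ring. apply Rabs_triang. }
  replace ((w + v) ^ 2 / (2 * (tau + s))) with (/ 2 * ((w + v) ^ 2 / (tau + s))) by (field; lra).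
  replace (w ^ 2 / (2 * tau)) with (/ 2 * (w ^ 2 / tau)) by (field; lra).
  replace (v ^ 2 / (2 * s)) with (/ 2 * (v ^ 2 / s)) by (field; lra).
  apply Rmult_le_compat_l with (r := beta) in P; [|lra].
  apply Rmult_le_compat_l with (r := lam) in A; [|lra]. lra.
Qed.

(** Replacing the absolute value by its tangent at [th] leaves a quadratic in [w], minimised
    explicitly; its term odd in [z] disappears by symmetry. Meant for coordinates of arbitrary
    size. *)
Lemma risk_ge_large lam beta tau th : 0 < lam -> 0 < beta -> 0 < tau ->
  - (beta * tau / 2) * (1 + (lam / beta) ^ 2) <= risk lam beta tau th.
Proof.
  intros.
  assert (B : gauss_E (fun z => 1 * z ^ 2 + (lam / beta) ^ 2 * 1) <= 1 + (lam / beta) ^ 2).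
  { rewrite (gauss_E_lin (fun z => z ^ 2) (fun _ => 1)) by adm.
    pose proof gauss_E_pow2. pose proof gauss_E_1. pose proof (pow2_ge_0 (lam / beta)). nra. }
  assert (C : 0 < beta * tau / 2) by nra.
  apply Rle_trans with ((- (beta * tau / 2)) * gauss_E (fun z => 1 * z ^ 2 + (lam / beta) ^ 2 * 1)
     + 0 * gauss_E (fun _ => 0)); [nra|].
  rewrite <- gauss_E_lin by adm. unfold risk. 
  set (s := if Rle_dec 0 th then 1 else - 1).
  assert (Hs : s ^ 2 = 1) by (unfold s; destruct Rle_dec; ring).
  assert (L : forall z, - (beta * tau / 2) * (z - s * (lam / beta)) ^ 2 <= inner_min lam beta tau th z).
  { intros z. destruct (inner_min_attained lam beta tau th z) as [w E]; try lra. rewrite E. unfold inner.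
    assert (A : s * w <= Rabs (w + th) - Rabs th).
    { unfold s. destruct Rle_dec; unfold Rabs; repeat destruct Rcase_abs; lra. }
    apply Rmult_le_compat_l with (r := lam) in A; [|lra].
    enough (0 <= w ^ 2 / (2 * tau) * beta - beta * z * w + lam * (s * w)
      + beta * tau / 2 * (z - s * (lam / beta)) ^ 2) by lra.
    replace (_ + _) with (beta / (2 * tau) * (w - tau * (z - s * (lam / beta))) ^ 2) by (field; lra).
    apply Rmult_le_pos; [apply Rlt_le, Rdiv_lt_0_compat; lra|apply pow2_ge_0]. }
  apply gauss_E_le_sym; [adm..|]. intros z. pose proof (L z). pose proof (L (- z)).
  eapply Rle_trans; [|apply Rplus_le_compat; [apply L|apply L]].
  right. replace ((z - s * (lam / beta)) ^ 2) with (z ^ 2 + s ^ 2 * (lam / beta) ^ 2 - 2 * z * s * (lam / beta)) by ring.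
  replace ((- z - s * (lam / beta)) ^ 2) with (z ^ 2 + s ^ 2 * (lam / beta) ^ 2 + 2 * z * s * (lam / beta)) by ring.
  rewrite Hs. field. lra.
Qed.

(** Since [|w + th| - |th| >= |w| - 2 |th|], the problem reduces to [th = 0], where the mean is
    exactly [- beta tau M(lam / beta)], at a cost independent of [tau]. *)
Lemma risk_ge_small lam beta tau th : 0 < lam -> 0 < beta -> 0 < tau ->
  - (beta * tau) * Mfun (lam / beta) - 2 * lam * Rabs th <= risk lam beta tau th.
Proof.
  intros. assert (Ha : 0 < lam / beta) by (apply Rdiv_lt_0_compat; lra).
  pose proof (Rabs_pos th) as Pth.
  apply Rle_trans with ((- (beta * tau / 2)) * gauss_E (fun z => excess (lam / beta) z ^ 2)
    + (- (2 * lam * Rabs th)) * gauss_E (fun _ => 1)).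
  { rewrite gauss_E_excess by lra. pose proof gauss_E_1 as G1.
    apply Rmult_le_compat_l with (r := 2 * lam * Rabs th) in G1; [lra|]. apply Rmult_le_pos; lra. }
  rewrite <- gauss_E_lin by adm. unfold risk. apply gauss_E_le; [adm..|]. intros z.
  destruct (inner_min_attained lam beta tau th z) as [w E]; try lra.
  pose proof (inner_formula_le lam beta tau 0 z w ltac:(lra) ltac:(lra) ltac:(lra)) as L.
  replace (inner_formula lam beta tau 0 z) with (- (beta * tau / 2) * excess (lam / beta) z ^ 2) in L.
  2: { unfold inner_formula. rewrite Rabs_R0.
       replace (excess (tau * (lam / beta)) (0 + tau * z)) with (tau * excess (lam / beta) z).
       - field. lra.
       - unfold excess. rewrite Rplus_0_l, Rabs_mult, (Rabs_pos_eq tau) by lra.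
         rewrite <- RmaxRmult by lra. f_equal; ring. }
  rewrite E. unfold inner in *. rewrite Rabs_R0, Rplus_0_r in L.
  assert (A : Rabs w - Rabs th <= Rabs (w + th)).
  { pose proof (Rabs_triang (w + th) (- th)) as T. rewrite Rabs_Ropp in T.
    replace (w + th + - th) with w in T by ring. lra. }
  apply Rmult_le_compat_l with (r := lam) in A; lra.
Qed.

(** If neither term is clipped the sum is [2 m ^ 2 + 2 z ^ 2]. If one is, the sum is at least
    [a ^ 2], which exceeds the left side by completing a square in [z ^ 2]. *)
Lemma clip_sym_ge a m z : 0 < a ->
  2 * z ^ 2 - 4 * (z ^ 4 / a ^ 2) <= Rmin (Rabs (m + z)) a ^ 2 + Rmin (Rabs (m - z)) a ^ 2.
Proof.
  intros Ha.
  assert (Q : forall x, Rmin (Rabs x) a ^ 2 = x ^ 2 \/ Rmin (Rabs x) a ^ 2 = a ^ 2).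
  { intros x. unfold Rmin. rewrite <- (pow2_abs x). destruct Rle_dec; tauto. }
  assert (K : 2 * z ^ 2 - 4 * (z ^ 4 / a ^ 2) <= a ^ 2).
  { apply Rmult_le_reg_r with (a ^ 2); [nra|].
    replace ((2 * z ^ 2 - 4 * (z ^ 4 / a ^ 2)) * a ^ 2) with (2 * z ^ 2 * a ^ 2 - 4 * z ^ 4) by (field; lra).
    pose proof (pow2_ge_0 (2 * z ^ 2 - a ^ 2 / 2)). nra. }
  assert (Z : 0 <= z ^ 4 / a ^ 2).
  { apply Rmult_le_pos; [nra|]. apply Rlt_le, Rinv_0_lt_compat. nra. }
  pose proof (pow2_ge_0 (Rmin (Rabs (m + z)) a)). pose proof (pow2_ge_0 (Rmin (Rabs (m - z)) a)).
  destruct (Q (m + z)) as [E1|L1]; [destruct (Q (m - z)) as [E2|L2]|]; [|lra..].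
  rewrite E1, E2. pose proof (pow2_ge_0 m). lra.
Qed.

(* The derivative of the inner minimum in [beta] is [w ^ 2 / (2 tau) - z w] at the minimiser [w];
   its mean is bounded below uniformly in [th]. *)
Lemma risk_incr_beta lam b b' tau th : 0 < lam -> 0 <= b < b' -> 0 < tau ->
  - (b' - b) * tau * (3 * (b' / lam) ^ 2) <= risk lam b' tau th - risk lam b tau th.
Proof.
  intros Hl Hb Ht.
  set (a := lam / b'). assert (Ha : 0 < a) by (apply Rdiv_lt_0_compat; lra).
  assert (Ea : (b' / lam) ^ 2 = / a ^ 2) by (unfold a; field; lra). rewrite Ea.
  assert (Pa : 0 < / a ^ 2) by (apply Rinv_0_lt_compat; nra).
  set (k := (b' - b) * tau * / a ^ 2). assert (Hk : 0 < k) by (unfold k; repeat apply Rmult_lt_0_compat; lra).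
  apply Rle_trans with (- k * gauss_E (fun z => z ^ 4) + 0 * gauss_E (fun _ => 0)).
  { replace (- (b' - b) * tau * (3 * / a ^ 2)) with (- k * 3) by (unfold k; ring). pose proof gauss_E_pow4. nra. }
  replace (risk lam b' tau th - risk lam b tau th) with (1 * risk lam b' tau th + (- 1) * risk lam b tau th) by ring.
  unfold risk. rewrite <- !gauss_E_lin by adm.
  (* The minimiser [w] at [b'] competes at [b], and the objective is affine in [beta]. There
     [w - tau z] is minus the clipping of [th + tau z] at level [tau a]. *)
  assert (L : forall z, (b' - b) * tau / 2 * (Rmin (Rabs (th / tau + z)) a ^ 2 - z ^ 2)
     <= 1 * inner_min lam b' tau th z + (- 1) * inner_min lam b tau th z).
  { intros z. rewrite (inner_min_formula lam b') by lra. rewrite <- inner_soft by lra. fold a.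
    set (w := soft (tau * a) (th + tau * z) - th).
    pose proof (inner_min_le lam b tau th z w ltac:(lra) ltac:(lra) ltac:(lra)) as M.
    apply Rle_trans with (inner lam b' tau th z w - inner lam b tau th z w); [|lra].
    replace (inner lam b' tau th z w - inner lam b tau th z w) with
      ((b' - b) / (2 * tau) * ((w - tau * z) ^ 2 - (tau * z) ^ 2)) by (unfold inner; field; lra).
    right.
    replace ((w - tau * z) ^ 2) with (tau ^ 2 * Rmin (Rabs (th / tau + z)) a ^ 2); [field; lra|].
    replace (th / tau + z) with ((th + tau * z) / tau) by (field; lra).
    unfold w. set (x := th + tau * z). replace (soft (tau * a) x - th - tau * z) with (soft (tau * a) x - x) by (unfold x; ring).
    rewrite Rabs_div, (Rabs_pos_eq tau), <- Rpow_mult_distr by lra.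
    replace (tau * Rmin (Rabs x / tau) a) with (Rmin (Rabs x) (tau * a)).
    2: { replace (Rabs x) with (tau * (Rabs x / tau)) at 1 by (field; lra).
         generalize (Rabs x / tau). intros y. unfold Rmin. destruct (Rle_dec y a), Rle_dec; nra. }
    unfold soft, Rmin. destruct (Rle_dec (Rabs x) (tau * a)).
    - rewrite pow2_abs. ring.
    - destruct Rle_dec; ring. }
  apply gauss_E_le_sym; [adm..|]. intros z.
  eapply Rle_trans; [|apply Rplus_le_compat; [apply L|apply L]].
  pose proof (clip_sym_ge a (th / tau) z Ha) as S.
  replace (th / tau - z) with (th / tau + - z) in S by ring.
  set (c := (b' - b) * tau / 2). assert (Hc : 0 <= c) by (unfold c; nra).
  replace k with (2 * c / a ^ 2) by (unfold k, c; field; lra).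
  replace ((- z) ^ 4) with (z ^ 4) by ring. replace ((- z) ^ 2) with (z ^ 2) by ring.
  apply Rmult_le_compat_l with (r := c) in S; [|lra].
  replace (- (2 * c / a ^ 2) * z ^ 4 + 0 * 0 + (- (2 * c / a ^ 2) * z ^ 4 + 0 * 0))
    with (c * (2 * z ^ 2 - 4 * (z ^ 4 / a ^ 2)) - 2 * c * z ^ 2) by (field; lra).
  lra.
Qed.

(** * The potential and its max-min pairs *)

Definition avg (N : nat) (f : nat -> R) : R := / INR N * sumN N f.

Lemma sumN_lin N f g a b : sumN N (fun i => a * f i + b * g i) = a * sumN N f + b * sumN N g.
Proof. induction N as [|N IH]; simpl; [ring|rewrite IH; ring]. Qed.

Lemma sumN_le N f g : (forall i, f i <= g i) -> sumN N f <= sumN N g.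
Proof. intros H. induction N as [|N IH]; simpl; [lra|specialize (H N); lra]. Qed.

Lemma sumN_const N c : sumN N (fun _ => c) = INR N * c.
Proof. induction N as [|N IH]; [simpl; ring|]. rewrite S_INR. simpl sumN. rewrite IH. ring. Qed.

Lemma avg_lin N f g a b : avg N (fun i => a * f i + b * g i) = a * avg N f + b * avg N g.
Proof. unfold avg. rewrite sumN_lin. ring. Qed.

Lemma inv_INR_nonneg N : 0 <= / INR N.
Proof.
  (* For [N = 0] the inverse takes its default value 0. *)
  destruct N as [|N]; [simpl; rewrite Rinv_0; lra|].
  apply Rlt_le, Rinv_0_lt_compat, lt_0_INR. lia.
Qed.

Lemma avg_le N f g : (forall i, f i <= g i) -> avg N f <= avg N g.
Proof. intros H. apply Rmult_le_compat_l; [apply inv_INR_nonneg|now apply sumN_le]. Qed.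

Lemma avg_const N c : (1 <= N)%nat -> avg N (fun _ => c) = c.
Proof.
  intros H. unfold avg. rewrite sumN_const. field. apply not_0_INR. lia.
Qed.

Lemma psi_avg delta sigma N theta lam beta tau :
  psi delta sigma N theta lam beta tau =
  (sigma ^ 2 / tau + tau) * beta / 2 - / 2 * beta ^ 2 + / delta * avg N (fun i => risk lam beta tau (theta i)).
Proof. reflexivity. Qed.

Section Potential.

Context (delta sigma : R) (N : nat) (theta : nat -> R) (lam : R).
Hypotheses (Hdelta : 0 < delta) (Hsigma : 0 < sigma) (HN : (1 <= N)%nat) (Hlam : 0 < lam).

Local Notation Psi := (psi delta sigma N theta lam).

Lemma inv_delta_pos : 0 < / delta.
Proof. now apply Rinv_0_lt_compat. Qed.

Lemma psi_concave_beta b1 b2 tau t : 0 <= b1 -> 0 <= b2 -> 0 < tau -> 0 <= t <= 1 ->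
  (1 - t) * Psi b1 tau + t * Psi b2 tau <= Psi ((1 - t) * b1 + t * b2) tau.
Proof.
  intros. rewrite !psi_avg.
  assert (A : (1 - t) * avg N (fun i => risk lam b1 tau (theta i)) + t * avg N (fun i => risk lam b2 tau (theta i))
    <= avg N (fun i => risk lam ((1 - t) * b1 + t * b2) tau (theta i))).
  { rewrite <- avg_lin. apply avg_le. intros. now apply risk_concave_beta. }
  apply Rmult_le_compat_l with (r := / delta) in A; [|apply Rlt_le, inv_delta_pos].
  assert (0 <= t * (1 - t) * (b1 - b2) ^ 2) by (apply Rmult_le_pos; [nra|apply pow2_ge_0]).
  nra.
Qed.

(** The quantitative gap comes from [sigma ^ 2 / tau] alone: it is [1 / t1 + 1 / t2 - 4 / (t1 + t2)]
    up to a factor. *)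
Lemma psi_strictly_midconvex_tau beta t1 t2 : 0 <= beta -> 0 < t1 -> 0 < t2 ->
  beta * sigma ^ 2 / 2 * ((t1 - t2) ^ 2 / (t1 * t2 * (t1 + t2)))
  <= Psi beta t1 + Psi beta t2 - 2 * Psi beta ((t1 + t2) / 2).
Proof.
  intros. rewrite !psi_avg.
  assert (A : 2 * avg N (fun i => risk lam beta ((t1 + t2) / 2) (theta i)) + 0 * avg N (fun _ => 0)
    <= 1 * avg N (fun i => risk lam beta t1 (theta i)) + 1 * avg N (fun i => risk lam beta t2 (theta i))).
  { rewrite <- !avg_lin. apply avg_le. intros.
    pose proof (risk_midconvex_tau lam beta t1 t2 (theta i)). lra. }
  apply Rmult_le_compat_l with (r := / delta) in A; [|apply Rlt_le, inv_delta_pos].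
  apply Rle_trans with ((sigma ^ 2 / t1 + t1) * beta / 2 + (sigma ^ 2 / t2 + t2) * beta / 2
     - 2 * ((sigma ^ 2 / ((t1 + t2) / 2) + (t1 + t2) / 2) * beta / 2)); [right; field; lra|lra].
Qed.

(** At [tau = sigma] the explicit part is [sigma beta - beta ^ 2 / 2 <= sigma ^ 2 / 2], and the risk
    is nonpositive. *)
Lemma psi_sigma_le beta : 0 <= beta -> Psi beta sigma <= sigma ^ 2 / 2.
Proof.
  intros. rewrite psi_avg.
  assert (A : avg N (fun i => risk lam beta sigma (theta i)) <= 0).
  { rewrite <- (avg_const N 0 HN). apply avg_le. intros. now apply risk_nonpos. }
  apply Rmult_le_compat_l with (r := / delta) in A; [|apply Rlt_le, inv_delta_pos].
  replace (sigma ^ 2 / sigma) with sigma by (field; lra).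
  pose proof (pow2_ge_0 (sigma - beta)). lra.
Qed.

(** Averages [risk_add_tau]; strictness comes from the decrease of [sigma ^ 2 / tau]. *)
Lemma psi_add_tau beta tau s : 0 < beta -> 0 < tau -> 0 < s ->
  Psi beta (tau + s) < Psi beta tau + s * beta * (/ 2 - Mfun (lam / beta) / delta).
Proof.
  intros. rewrite !psi_avg.
  assert (A : avg N (fun i => risk lam beta (tau + s) (theta i)) <=
    1 * avg N (fun i => risk lam beta tau (theta i)) + (- (s * beta * Mfun (lam / beta))) * avg N (fun _ => 1)).
  { rewrite <- avg_lin. apply avg_le. intros.
    pose proof (risk_add_tau lam beta tau s (theta i)). lra. }
  rewrite avg_const in A by assumption.
  apply Rmult_le_compat_l with (r := / delta) in A; [|apply Rlt_le, inv_delta_pos].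
  assert (B : sigma ^ 2 / (tau + s) < sigma ^ 2 / tau).
  { apply Rmult_lt_compat_l; [nra|]. apply Rinv_lt_contravar; nra. }
  apply Rmult_lt_compat_r with (r := beta) in B; [|lra].
  unfold Rdiv at 6. lra.
Qed.

Lemma psi_incr_beta b b' tau : 0 <= b < b' -> b' <= sigma / 2 -> 3 * (b' / lam) ^ 2 <= delta / 4 -> 0 < tau ->
  Psi b tau + (b' - b) * sigma / 10 <= Psi b' tau.
Proof.
  intros Hb Hs Hl Ht. rewrite !psi_avg.
  assert (A : (- ((b' - b) * tau * (delta / 4))) * avg N (fun _ => 1) + 1 * avg N (fun i => risk lam b tau (theta i))
    <= avg N (fun i => risk lam b' tau (theta i))).
  { rewrite <- avg_lin. apply avg_le. intros.
    pose proof (risk_incr_beta lam b b' tau (theta i) Hlam Hb Ht).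
    assert (0 < (b' - b) * tau) by nra. nra. }
  rewrite avg_const in A by assumption.
  apply Rmult_le_compat_l with (r := / delta) in A; [|apply Rlt_le, inv_delta_pos].
  replace (/ delta * (- ((b' - b) * tau * (delta / 4)) * 1 + 1 * avg N (fun i => risk lam b tau (theta i))))
    with (- ((b' - b) * tau / 4) + / delta * avg N (fun i => risk lam b tau (theta i))) in A by (field; lra).
  (* The risk may consume half of the slope [tau / 2]. The remainder is at least
     [sigma / sqrt 2 > 0.6 sigma], and subtracting [(b + b') / 2 <= sigma / 2] leaves
     [sigma / 10]. *)
  assert (B : 6 / 10 * sigma <= sigma ^ 2 / tau / 2 + tau / 4).
  { apply Rmult_le_reg_r with tau; [lra|].
    replace ((sigma ^ 2 / tau / 2 + tau / 4) * tau) with (sigma ^ 2 / 2 + tau ^ 2 / 4) by (field; lra).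
    pose proof (pow2_ge_0 (6 / 5 * sigma - tau)). nra. }
  set (q := sigma ^ 2 / tau) in *.
  assert (C : (b' - b) * (sigma / 10) <= (b' - b) * (q / 2 + tau / 4 - (b + b') / 2)) by (apply Rmult_le_compat_l; lra).
  lra.
Qed.

(** [chi] marks the coordinates bounded by [risk_ge_large]; the others use [risk_ge_small]. The
    hypothesis on its average keeps the loss of slope in [tau] below [b (1 - kappa) / 2], out of the
    available [b / 2]. *)
Lemma psi_coercive alpha kappa K chi tau : 0 < alpha -> 0 < tau ->
  (forall i, (chi i = 0 /\ Rabs (theta i) <= K) \/ chi i = 1) ->
  avg N chi * (1 + alpha ^ 2 - 2 * Mfun alpha) <= delta - 2 * Mfun alpha - kappa * delta ->
  0 <= K ->
  lam / alpha * kappa / 2 * tau - ((lam / alpha) ^ 2 / 2 + 2 * lam * K / delta) <= Psi (lam / alpha) tau.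
Proof.
  intros Ha Ht Hchi Havg HK. rewrite psi_avg. set (b := lam / alpha).
  assert (Hb : 0 < b) by (apply Rdiv_lt_0_compat; lra).
  assert (Eb : lam / b = alpha) by (unfold b; field; lra).
  assert (A : (- (b * tau * Mfun alpha + 2 * lam * K)) * avg N (fun _ => 1)
      + (- (b * tau / 2 * (1 + alpha ^ 2 - 2 * Mfun alpha))) * avg N chi
    <= avg N (fun i => risk lam b tau (theta i))).
  { rewrite <- avg_lin. apply avg_le. intros i. destruct (Hchi i) as [[-> Hi]| ->].
    - pose proof (risk_ge_small lam b tau (theta i) Hlam Hb Ht) as R. rewrite Eb in R.
      apply Rmult_le_compat_l with (r := 2 * lam) in Hi; lra.
    - pose proof (risk_ge_large lam b tau (theta i) Hlam Hb Ht) as R. rewrite Eb in R.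
      assert (0 <= 2 * lam * K) by nra. lra. }
  rewrite avg_const in A by assumption.
  assert (Hbt : 0 < b * tau / 2) by nra.
  apply Rmult_le_compat_l with (r := b * tau / 2) in Havg; [|lra].
  assert (A' : - (2 * lam * K) - b * tau / 2 * (delta - kappa * delta) <= avg N (fun i => risk lam b tau (theta i))) by lra.
  apply Rmult_le_compat_l with (r := / delta) in A'; [|apply Rlt_le, inv_delta_pos].
  replace (/ delta * (- (2 * lam * K) - b * tau / 2 * (delta - kappa * delta)))
    with (- (2 * lam * K / delta) - b * tau / 2 * (1 - kappa)) in A' by (field; lra).
  assert (0 <= sigma ^ 2 / tau * b / 2).
  { apply Rmult_le_pos; [|lra]. apply Rmult_le_pos; [|lra].
    apply Rmult_le_pos; [apply pow2_ge_0|apply Rlt_le, Rinv_0_lt_compat; lra]. }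
  lra.
Qed.

Lemma maxmin_beta_ge b' beta tau : 0 < b' -> b' <= sigma / 2 -> 3 * (b' / lam) ^ 2 <= delta / 4 ->
  maxmin_pair delta sigma N theta lam beta tau -> b' <= beta.
Proof.
  intros Hb Hs Hl (B0 & T0 & Hmin & Hmax). apply Rnot_lt_le. intros L.
  (* The tolerance is half the gain guaranteed by [psi_incr_beta]. *)
  assert (P : 0 < (b' - beta) * sigma / 20) by nra.
  destruct (Hmax b' ltac:(lra) _ P) as (tau' & Ht' & H).
  pose proof (Hmin tau' Ht'). pose proof (psi_incr_beta beta b' tau' ltac:(lra) Hs Hl ltac:(lra)). lra.
Qed.

Lemma maxmin_beta_lt a beta tau : 0 < a -> Mfun a = delta / 2 -> 0 < beta ->
  maxmin_pair delta sigma N theta lam beta tau -> beta < lam / a.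
Proof.
  intros Ha HM Hb (B0 & T0 & Hmin & Hmax). apply Rnot_le_lt. intros L.
  assert (La : lam / beta <= a).
  { apply Rmult_le_reg_r with (beta / a); [apply Rdiv_lt_0_compat; lra|].
    replace (lam / beta * (beta / a)) with (lam / a) by (field; lra).
    replace (a * (beta / a)) with beta by (field; lra). exact L. }
  assert (0 < lam / beta) by (apply Rdiv_lt_0_compat; lra).
  pose proof (Mfun_decr (lam / beta) a ltac:(lra)) as M. rewrite HM in M.
  pose proof (psi_add_tau beta tau 1 Hb ltac:(lra) ltac:(lra)) as S.
  pose proof (Hmin (tau + 1) ltac:(lra)).
  assert (/ 2 <= Mfun (lam / beta) / delta).
  { apply Rmult_le_reg_r with delta; [lra|]. unfold Rdiv. rewrite Rmult_assoc, Rinv_l; lra. }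
  nra.
Qed.

(* Move from [beta] a small step [s] towards the coercive point [bbar]. A near-minimiser of the
   perturbed function lies below [T] by coercivity, and is then a near-minimiser of [Psi beta],
   which strict convexity forbids when the minimiser [tau] exceeds [T]. *)
Lemma maxmin_tau_le bbar c C T beta tau : 0 <= bbar -> 0 < c -> 0 <= C -> sigma <= T ->
  (forall t, sigma <= t -> c * t - C <= Psi bbar t) -> sigma ^ 2 / 2 + 1 <= c * T - C ->
  0 < beta -> maxmin_pair delta sigma N theta lam beta tau -> tau <= T.
Proof.
  intros Hbb Hc HC HT Hco HTc Hb (B0 & T0 & Hmin & Hmax). apply Rnot_lt_le. intros L.
  set (V := Psi beta tau) in *.
  assert (HV : V <= sigma ^ 2 / 2).
  { eapply Rle_trans; [apply (Hmin sigma); lra|]. apply psi_sigma_le; lra. }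
  set (g := beta * sigma ^ 2 / 2 * ((tau - T) ^ 2 / (tau * T * (tau + T)))).
  assert (Hbs : 0 < beta * sigma ^ 2 / 2) by (assert (0 < beta * sigma ^ 2) by (apply Rmult_lt_0_compat; nra); lra).
  assert (Pden : forall t, sigma <= t -> 0 < tau * t * (tau + t)).
  { intros t Ht. apply Rmult_lt_0_compat; [apply Rmult_lt_0_compat|]; lra. }
  assert (Hg : 0 < g).
  { apply Rmult_lt_0_compat; [lra|]. apply Rdiv_lt_0_compat; [nra|]. now apply Pden. }
  (* The midpoint of [tau] and [t] has value at least [V], and the convexity gap only shrinks as [t]
     grows to [T]. *)
  assert (Gap : forall t, sigma <= t <= T -> V + g <= Psi beta t).
  { intros t Ht.
    pose proof (psi_strictly_midconvex_tau beta tau t ltac:(lra) ltac:(lra) ltac:(lra)) as S.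
    pose proof (Hmin ((tau + t) / 2) ltac:(lra)) as M. fold V in S.
    assert (g <= beta * sigma ^ 2 / 2 * ((tau - t) ^ 2 / (tau * t * (tau + t)))); [|lra].
    apply Rmult_le_compat_l; [lra|].
    apply Rmult_le_compat; [apply pow2_ge_0|apply Rlt_le, Rinv_0_lt_compat, Pden; lra| |].
    - apply pow_incr. lra.
    - apply Rinv_le_contravar; [apply Pden; lra|].
      apply Rmult_le_compat; [|lra| |lra]; [apply Rmult_le_pos; lra|].
      apply Rmult_le_compat_l; lra. }
  (* [Q] dominates [V + g + C + 1], so a step [s = g / (2 Q)] loses at most half the gap when
     [t <= T]. The tolerance [s ^ 2] chosen below is of smaller order than the gain [s] available
     when [t > T]. *)
  set (Q := g + 1 + sigma ^ 2 / 2 + C).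
  assert (HQ : g + 1 <= Q) by (unfold Q; nra).
  set (s := g / (2 * Q)).
  assert (Hs0 : 0 < s) by (apply Rdiv_lt_0_compat; lra).
  assert (HsQ : s * Q = g / 2) by (unfold s; field; lra).
  assert (Hs1 : s < 1) by nra.
  destruct (Hmax ((1 - s) * beta + s * bbar) ltac:(nra) (s ^ 2) ltac:(nra)) as (t & Ht & H).
  pose proof (psi_concave_beta beta bbar t s ltac:(lra) ltac:(lra) ltac:(lra) ltac:(lra)) as Cc.
  pose proof (Hco t Ht) as Hct.
  destruct (Rle_dec t T) as [LT|LT].
  - pose proof (Gap t (conj Ht LT)) as G.
    assert (- C <= Psi bbar t) by nra.
    assert ((1 - s) * (V + g) + s * (- C) <= V + s ^ 2) by nra.
    unfold Q in HsQ. nra.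
  - pose proof (Hmin t Ht) as G.
    assert (sigma ^ 2 / 2 + 1 <= Psi bbar t) by nra.
    assert ((1 - s) * V + s * (V + 1) <= V + s ^ 2) by nra.
    nra.
Qed.

End Potential.

(** * Coercivity constants for the two parameter classes *)

(* The inequality makes the slope of [psi] in [tau] at infinity, for [beta = lam / alpha], at least
   [beta * kappa / 2]; with [K = 0] it is the inequality defining [s_max]. *)
Definition sparse_above (delta : R) (D : nat -> (nat -> R) -> Prop) (alpha K kappa : R) : Prop :=
  forall N theta, (1 <= N)%nat -> D N theta ->
  exists chi, (forall i, (chi i = 0 /\ Rabs (theta i) <= K) \/ chi i = 1) /\
    avg N chi * (1 + alpha ^ 2 - 2 * Mfun alpha) <= delta - 2 * Mfun alpha - kappa * delta.

Lemma sumN_nnz N x : sumN N (fun i => if Req_EM_T (x i) 0 then 0 else 1) = INR (nnz N x).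
Proof.
  induction N as [|N IH]; [reflexivity|]. simpl sumN. simpl nnz. rewrite IH, plus_INR.
  destruct Req_EM_T; reflexivity.
Qed.

Lemma sparse_above_F0 delta s : 0 < delta -> lt_smax delta s ->
  exists alpha K kappa, 0 < alpha /\ 0 <= K /\ 0 < kappa /\ sparse_above delta (in_F0 s) alpha K kappa.
Proof.
  intros Hd (a & Ha & Hs). pose proof (Mfun_le_half a ltac:(lra)) as M.
  set (m := Mfun a) in *. set (q := 1 + a ^ 2 - 2 * m) in *.
  assert (Hq : 0 < q) by (unfold q; nra).
  assert (Hs' : s * q < delta - 2 * m).
  { apply Rmult_lt_compat_r with (r := q) in Hs; [|lra].
    replace (delta * ((1 - 2 / delta * m) / q) * q) with (delta - 2 * m) in Hs by (field; lra). exact Hs. }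
  (* [kappa] is the slack in the strict inequality for [s], divided by [delta]. *)
  exists a, 0, ((delta - 2 * m - s * q) / delta).
  repeat split; try lra; [apply Rdiv_lt_0_compat; lra|].
  intros N theta HN H. exists (fun i => if Req_EM_T (theta i) 0 then 0 else 1). split.
  - intros i. destruct Req_EM_T as [E|E]; [left|now right]. rewrite E, Rabs_R0. lra.
  - fold m q. unfold avg. rewrite sumN_nnz. unfold in_F0 in H.
    assert (HNp : 0 < INR N) by (apply lt_0_INR; lia).
    apply Rmult_le_compat_l with (r := / INR N) in H; [|apply inv_INR_nonneg].
    replace (/ INR N * (s * INR N)) with s in H by (field; lra).
    replace ((delta - 2 * m - s * q) / delta * delta) with (delta - 2 * m - s * q) by (field; lra).
    nra.
Qed.

Lemma sparse_above_Fp delta p xi : 0 < delta -> 0 < p ->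
  exists alpha K kappa, 0 < alpha /\ 0 <= K /\ 0 < kappa /\ sparse_above delta (in_Fp p xi) alpha K kappa.
Proof.
  intros Hd Hp.
  (* Then [a ^ 2 >= 12 / delta], and [Mfun_decay] gives [2 M(a) <= delta / 4]. *)
  set (a := 1 + 12 / delta). assert (H12 : 0 < 12 / delta) by (apply Rdiv_lt_0_compat; lra).
  assert (Ha : 1 < a) by (unfold a; lra).
  assert (M : 2 * Mfun a <= delta / 4).
  { pose proof (Mfun_decay a ltac:(lra)) as M. pose proof (Mfun_nonneg a ltac:(lra)) as M0.
    assert (12 / delta <= a ^ 2) by (unfold a; nra).
    assert (2 * Mfun a * (12 / delta) <= 3) by nra.
    apply Rmult_le_reg_r with (12 / delta); [lra|].
    replace (delta / 4 * (12 / delta)) with 3 by (field; lra). lra. }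
  pose proof (Mfun_nonneg a ltac:(lra)) as M0.
  (* At most a fraction [eps] of large coordinates costs at most [delta / 4]. Markov's inequality
     yields that fraction for the threshold [K] with [K ^ p = xi ^ p / eps]. *)
  set (eps := delta / (4 * (1 + a ^ 2))).
  assert (He : 0 < eps) by (apply Rdiv_lt_0_compat; nra).
  set (W := Rpower xi p / eps). assert (HX : 0 < Rpower xi p) by apply exp_pos.
  assert (HW : 0 < W) by (apply Rdiv_lt_0_compat; lra).
  set (K := Rpower W (/ p)). assert (HK : 0 < K) by apply exp_pos.
  assert (EK : Rpower K p = W).
  { unfold K. rewrite Rpower_mult, Rinv_l by lra. now apply Rpower_1. }
  exists a, K, (/ 2). repeat split; try lra.
  intros N theta HN H. exists (fun i => if Rle_dec (Rabs (theta i)) K then 0 else 1). split.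
  - intros i. destruct Rle_dec; [left; lra|now right].
  - assert (A : avg N (fun i => if Rle_dec (Rabs (theta i)) K then 0 else 1) <=
      / W * avg N (fun i => abspow (theta i) p) + 0 * avg N (fun _ => 0)).
    { rewrite <- avg_lin. apply avg_le. intros i.
      assert (HiW : 0 < / W) by now apply Rinv_0_lt_compat.
      unfold abspow. destruct Rle_dec as [Li|Li]; destruct Req_EM_T as [E|E]; try lra.
      - assert (0 < Rpower (Rabs (theta i)) p) by apply exp_pos. nra.
      - rewrite E, Rabs_R0 in Li. lra.
      - assert (R : Rpower K p <= Rpower (Rabs (theta i)) p) by (apply Rle_Rpower_l; lra).
        rewrite EK in R. apply Rmult_le_compat_l with (r := / W) in R; [|lra]. rewrite Rinv_l in R; lra. }
    unfold in_Fp in H. fold (avg N (fun i => abspow (theta i) p)) in H.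
    apply Rmult_le_compat_l with (r := / W) in H; [|apply Rlt_le, Rinv_0_lt_compat; lra].
    replace (/ W * Rpower xi p) with eps in H by (unfold W; field; lra).
    assert (E : eps * (1 + a ^ 2) = delta / 4) by (unfold eps; field; nra).
    assert (B : avg N (fun i => if Rle_dec (Rabs (theta i)) K then 0 else 1) <= eps) by lra.
    pose proof (Mfun_le_half a ltac:(lra)).
    apply Rmult_le_compat_r with (r := 1 + a ^ 2 - 2 * Mfun a) in B; [|nra]. nra.
Qed.

(** * Choice of the uniform constants *)

Theorem theoremA3 (delta sigma lam_min lam_max : R)
  (D : nat -> (nat -> R) -> Prop)
  (Hdelta : 0 < delta) (Hsigma : 0 < sigma)
  (Hlmin : 0 < lam_min) (Hlmm : lam_min <= lam_max)
  (HD : (exists s, 0 <= s /\ lt_smax delta s /\ D = in_F0 s) \/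
        (exists p xi, 0 < p /\ 0 < xi /\ D = in_Fp p xi)) :
  exists beta_min tau_max, 0 < beta_min /\ 0 < tau_max /\
    forall (N : nat) (theta : nat -> R) (lam beta tau : R),
      (1 <= N)%nat -> D N theta -> lam_min <= lam <= lam_max ->
      maxmin_pair delta sigma N theta lam beta tau ->
      beta_min <= beta /\ sigma <= tau <= tau_max /\
      (delta < 1 -> forall a, 0 < a -> Mfun a = delta / 2 -> beta < lam / a).
Proof.
  assert (HS : exists alpha K kappa, 0 < alpha /\ 0 <= K /\ 0 < kappa /\ sparse_above delta D alpha K kappa).
  { destruct HD as [(s & _ & Hs & ->)|(p & xi & Hp & _ & ->)].
    - now apply sparse_above_F0.
    - now apply sparse_above_Fp. }
  destruct HS as (alpha & K & kappa & Ha & HK & Hk & HS).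
  (* As [r <= 1], this gives [3 r ^ 2 <= 3 r <= delta / 4], the smallness needed for
     [bm / lam <= r]. *)
  set (r := Rmin 1 (delta / 12)).
  assert (Hr : 0 < r /\ r <= 1 /\ r <= delta / 12).
  { unfold r. split; [apply Rmin_pos; lra|split; [apply Rmin_l|apply Rmin_r]]. }
  set (bm := Rmin (sigma / 2) (lam_min * r)).
  assert (Hbm : 0 < bm /\ bm <= sigma / 2 /\ bm <= lam_min * r).
  { unfold bm. split; [apply Rmin_pos; nra|split; [apply Rmin_l|apply Rmin_r]]. }
  (* Uniformity in [lam]: the coercive slope is taken at [lam_min], the offset at [lam_max]. *)
  set (c := lam_min / alpha * kappa / 2).
  set (C := (lam_max / alpha) ^ 2 / 2 + 2 * lam_max * K / delta).
  assert (Hia : 0 < / alpha) by now apply Rinv_0_lt_compat.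
  assert (Hid : 0 < / delta) by now apply Rinv_0_lt_compat.
  assert (Hc : 0 < c).
  { unfold c. assert (0 < lam_min / alpha) by (apply Rdiv_lt_0_compat; lra). nra. }
  set (T := Rmax sigma ((C + sigma ^ 2 / 2 + 1) / c)).
  assert (HT : sigma <= T) by apply Rmax_l.
  assert (HTc : sigma ^ 2 / 2 + 1 <= c * T - C).
  { assert (Q : (C + sigma ^ 2 / 2 + 1) / c <= T) by apply Rmax_r.
    apply Rmult_le_compat_l with (r := c) in Q; [|lra].
    replace (c * ((C + sigma ^ 2 / 2 + 1) / c)) with (C + sigma ^ 2 / 2 + 1) in Q by (field; lra). lra. }
  exists bm, T. split; [lra|]. split; [lra|].
  intros N theta lam beta tau HN HDN Hlam Hmm.
  assert (Hl : 0 < lam) by lra.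
  assert (Hbeta : bm <= beta).
  { apply (maxmin_beta_ge delta sigma N theta lam) with (tau := tau); try assumption; try lra.
    assert (Hq : 0 <= bm / lam <= r).
    { split; [apply Rlt_le, Rdiv_lt_0_compat; lra|].
      apply Rmult_le_reg_r with lam; [lra|]. replace (bm / lam * lam) with bm by (field; lra). nra. }
    nra. }
  split; [exact Hbeta|]. split; [split; [apply Hmm|]|].
  - destruct (HS N theta HN HDN) as (chi & Hchi & Havg).
    assert (Hla : lam_min / alpha <= lam / alpha <= lam_max / alpha).
    { split; apply Rmult_le_compat_r; lra. }
    assert (Hla0 : 0 < lam_min / alpha) by (apply Rdiv_lt_0_compat; lra).
    apply (maxmin_tau_le delta sigma N theta lam Hdelta Hsigma HN Hl (lam / alpha) c C T beta tau); try lra.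
    + unfold C. assert (0 <= 2 * lam_max * K / delta) by (apply Rmult_le_pos; [apply Rmult_le_pos|]; lra).
      pose proof (pow2_ge_0 (lam_max / alpha)). lra.
    + intros t Ht.
      eapply Rle_trans; [|apply (psi_coercive delta sigma N theta lam Hdelta HN Hl alpha kappa K chi t Ha ltac:(lra) Hchi Havg HK)].
      assert (c * t <= lam / alpha * kappa / 2 * t).
      { unfold c. apply Rmult_le_compat_r; [lra|]. apply Rmult_le_compat_r; [lra|]. apply Rmult_le_compat_r; lra. }
      assert ((lam / alpha) ^ 2 <= (lam_max / alpha) ^ 2) by (apply pow_incr; lra).
      assert (2 * lam * K / delta <= 2 * lam_max * K / delta).
      { apply Rmult_le_compat_r; [lra|]. apply Rmult_le_compat_r; lra. }
      unfold C. lra.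
    + exact Hmm.
  - intros _ a Ha' HM. apply (maxmin_beta_lt delta sigma N theta lam) with (tau := tau); try assumption. lra.
Qed.
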